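(* Let $O=\{(L_1,\Gamma): L_1>0,\ 0<\Gamma<L_1\sqrt{3/5}\}\subset\mathbb{R}^2$ and let $\mathcal{L}_{L_1,\Gamma}(\gamma^0)$ be the Poincaré–Melnikov potential $$\mathcal{L}_{L_1,\Gamma}(\gamma^0)=\int_{-\infty}^{+\infty}H_2\big(g_1^h(t),G_1^h(t),\gamma^h(t),\Gamma\big)\,dt ,$$ where $H_2$ is the octupolar term and $(g_1^h,G_1^h,\gamma^h,\Gamma)$ is the separatrix solution of $H_0$ with $g_1^h(0)=\pi/2$, $\gamma^h(0)=\gamma^0$. There exists a non-constant real analytic function $\mathcal{L}^+:O\to\mathbb{C}$, $(L_1,\Gamma)\mapsto\mathcal{L}^+_{L_1,\Gamma}$, such that $$\mathcal{L}_{L_1,\Gamma}(\gamma^0)=\mathcal{L}^+_{L_1,\Gamma}e^{i\gamma^0}+\overline{\mathcal{L}^+_{L_1,\Gamma}}\,e^{-i\gamma^0}.$$ In particular, outside an analytic subset of $O$ of empty interior, $\mathcal{L}^+$ does not vanish and thus $\mathcal{L}_{L_1,\Gamma}$ (as a function of $\gamma^0\in\mathbb{T}$) has non-degenerate critical points.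
   Context: For $(L_1,\Gamma)\in O$ ($L_1$ is a parameter), in the symplectic coordinates $(g_1,G_1,\gamma,\Gamma)$ with $g_1,\gamma\in\mathbb{T}=\mathbb{R}/2\pi\mathbb{Z}$ and $0<G_1\le L_1$, let $$H_0=\Big(1-\frac{G_1^2}{L_1^2}\Big)\Big[2-5\Big(1-\frac{\Gamma^2}{G_1^2}\Big)\sin^2g_1\Big]-\frac{\Gamma^2}{L_1^2},$$ with Hamilton's equations $\dot g_1=\partial_{G_1}H_0$, $\dot G_1=-\partial_{g_1}H_0$, $\dot\gamma=\partial_\Gamma H_0$, $\dot\Gamma=0$. The separatrix solution $t\mapsto(g_1^h(t),G_1^h(t),\gamma^h(t),\Gamma)$ is the solution of this system lying on the curve $(1-\Gamma^2/G_1^2)\sin^2g_1=2/5$, $\Gamma<G_1<L_1$, $g_1\in\,]0,\pi[$, with $g_1^h(0)=\pi/2$ and $\gamma^h(0)=\gamma^0$; as $t\to\pm\infty$, $G_1^h(t)\to L_1$ exponentially fast. The octupolar term is $$H_2=A_{\mathrm{oct}}\,e_1\big(\cos g_1\cos\gamma\;A+\sin g_1\sin\gamma\cos i\;B\big),$$ where $e_1=\sqrt{1-G_1^2/L_1^2}$, $\cos i=\Gamma/G_1$, $\sin^2i=1-\Gamma^2/G_1^2$, $$A=\tfrac{G_1^2}{L_1^2}\big(5\sin^2i\,(-7\cos^2g_1+6)-3\big)-35\sin^2g_1\sin^2i+7,$$ $$B=\tfrac{G_1^2}{L_1^2}\big(5\sin^2i\,(7\cos^2g_1-4)+3\big)+35\sin^2g_1\sin^2i-7,$$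 $$A_{\mathrm{oct}}=-\frac{15}{64}\frac{a_1^3}{a_2^4}\frac{e_2}{(1-e_2^2)^{5/2}}.$$ Here $a_2>0$ and $e_2\in(0,1)$ are fixed constants, and $a_1=L_1^2/(\mu_1^2M_1)$ with $\mu_1,M_1>0$ fixed constants (depending only on the masses). *)

(* Defs.v *)
From Stdlib Require Import Reals ClassicalEpsilon.
From Coquelicot Require Export Coquelicot.
Open Scope R_scope.

(* The first coordinate is L_1, the second is Gamma. *)
Definition dom_O (p : R * R) : Prop :=
  0 < fst p /\ 0 < snd p < fst p * sqrt (3 / 5).

(* Gamma is the conjugate momentum of the cyclic angle gamma, on which H0 does
   not depend. *)
Definition H0 (L1 g1 G1 Gam : R) : R :=
  (1 - G1 ^ 2 / L1 ^ 2) * (2 - 5 * (1 - Gam ^ 2 / G1 ^ 2) * sin g1 ^ 2)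
  - Gam ^ 2 / L1 ^ 2.

Definition cos_i (G1 Gam : R) : R := Gam / G1.
Definition sin2_i (G1 Gam : R) : R := 1 - Gam ^ 2 / G1 ^ 2.
Definition ecc1 (L1 G1 : R) : R := sqrt (1 - G1 ^ 2 / L1 ^ 2).

Definition coefA (L1 g1 G1 Gam : R) : R :=
  G1 ^ 2 / L1 ^ 2 * (5 * sin2_i G1 Gam * (- 7 * cos g1 ^ 2 + 6) - 3)
  - 35 * sin g1 ^ 2 * sin2_i G1 Gam + 7.

Definition coefB (L1 g1 G1 Gam : R) : R :=
  G1 ^ 2 / L1 ^ 2 * (5 * sin2_i G1 Gam * (7 * cos g1 ^ 2 - 4) + 3)
  + 35 * sin g1 ^ 2 * sin2_i G1 Gam - 7.

Definition axis1 (mu1 M1 L1 : R) : R := L1 ^ 2 / (mu1 ^ 2 * M1).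

Definition Aoct (a2 e2 mu1 M1 L1 : R) : R :=
  - (15 / 64) * (axis1 mu1 M1 L1 ^ 3 / a2 ^ 4)
  * (e2 / Rpower (1 - e2 ^ 2) (5 / 2)).

Definition H2 (a2 e2 mu1 M1 L1 g1 G1 gam Gam : R) : R :=
  Aoct a2 e2 mu1 M1 L1 * ecc1 L1 G1 *
  (cos g1 * cos gam * coefA L1 g1 G1 Gam
   + sin g1 * sin gam * cos_i G1 Gam * coefB L1 g1 G1 Gam).

(* A motion gives (g_1, G_1, gamma) at each time, the angles being lifted from
   R / 2 pi Z to R; Gamma is constant along it and stays a parameter. *)
Record motion : Type := Motion
  { mot_g1 : R -> R; mot_G1 : R -> R; mot_gam : R -> R }.

Definition is_separatrix (L1 Gam gam0 : R) (h : motion) : Prop :=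
  (forall t : R,
     is_derive (mot_g1 h) t
       (Derive (fun G => H0 L1 (mot_g1 h t) G Gam) (mot_G1 h t)) /\
     is_derive (mot_G1 h) t
       (- Derive (fun g => H0 L1 g (mot_G1 h t) Gam) (mot_g1 h t)) /\
     is_derive (mot_gam h) t
       (Derive (fun Y => H0 L1 (mot_g1 h t) (mot_G1 h t) Y) Gam)) /\
  (forall t : R,
     (1 - Gam ^ 2 / mot_G1 h t ^ 2) * sin (mot_g1 h t) ^ 2 = 2 / 5 /\
     Gam < mot_G1 h t < L1 /\
     0 < mot_g1 h t < PI) /\
  mot_g1 h 0 = PI / 2 /\
  mot_gam h 0 = gam0.

Definition separatrix (L1 Gam gam0 : R) : motion :=
  epsilon (inhabits (Motion (fun _ => 0) (fun _ => 0) (fun _ => 0)))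
    (is_separatrix L1 Gam gam0).

Definition H2_along (a2 e2 mu1 M1 L1 Gam : R) (h : motion) (t : R) : R :=
  H2 a2 e2 mu1 M1 L1 (mot_g1 h t) (mot_G1 h t) (mot_gam h t) Gam.

Definition melnikov (a2 e2 mu1 M1 L1 Gam gam0 : R) : R :=
  RInt_gen (H2_along a2 e2 mu1 M1 L1 Gam (separatrix L1 Gam gam0))
    (Rbar_locally m_infty) (Rbar_locally p_infty).

Definition monomial2 (a : nat -> nat -> R) (u v : R) (n k : nat) : R :=
  a k (n - k)%nat * u ^ k * v ^ (n - k).

(* Near p, f is the sum of an absolutely convergent double power series,
   summed along the diagonals k + l = n. *)
Definition analytic_at (f : R * R -> R) (p : R * R) : Prop :=
  exists (a : nat -> nat -> R) (r : R), 0 < r /\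
  forall x y : R, Rabs (x - fst p) < r -> Rabs (y - snd p) < r ->
    ex_series (fun n =>
      sum_n (fun k => Rabs (monomial2 a (x - fst p) (y - snd p) n k)) n) /\
    is_series (fun n =>
      sum_n (fun k => monomial2 a (x - fst p) (y - snd p) n k) n) (f (x, y)).

Definition analytic_on (U : R * R -> Prop) (f : R * R -> R) : Prop :=
  forall p, U p -> analytic_at f p.

Definition Canalytic_on (U : R * R -> Prop) (f : R * R -> C) : Prop :=
  analytic_on U (fun p => Re (f p)) /\ analytic_on U (fun p => Im (f p)).

Definition analytic_subset (D Z : R * R -> Prop) : Prop :=
  (forall p, Z p -> D p) /\
  forall p, D p ->
    exists (U : R * R -> Prop) (m : nat) (f : nat -> R * R -> R),
      open U /\ U p /\ (forall q, U q -> D q) /\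
      (forall j, (j < m)%nat -> analytic_on U (f j)) /\
      (forall q, U q -> (Z q <-> forall j, (j < m)%nat -> f j q = 0)).

Definition empty_interior (Z : R * R -> Prop) : Prop :=
  forall p, ~ locally p Z.

(* exp (i theta) *)
Definition cis (theta : R) : C := (cos theta, sin theta).

Definition critical_point (F : R -> R) (x : R) : Prop := is_derive F x 0.

Definition nondegenerate_at (F : R -> R) (x : R) : Prop :=
  exists d : R, is_derive (Derive F) x d /\ d <> 0.

Definition has_nondegenerate_critical_points (F : R -> R) : Prop :=
  (exists x, critical_point F x) /\
  (forall x, critical_point F x -> nondegenerate_at F x).

(* Main.v *)
Require Import Defs.
From Stdlib Require Import Reals Lra Lia Factorial ClassicalEpsilon FunctionalExtensionality.
From Coquelicot Require Import Coquelicot.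
Open Scope R_scope.

(* On the separatrix the variable [w = G_1 cot g_1] satisfies the Riccati equation
   [w' = (4 / L_1^2) (W^2 - w^2)] with [2 W^2 = 3 L_1^2 - 5 Gamma^2], so that
   [w = W tanh (k t)] with [k = 4 W / L_1^2], and
     [3 G_1^2 = 2 w^2 + 5 Gamma^2],  [e_1 = sqrt (2/3) (W / L_1) sech (k t)],
     [gamma = gamma^0 + atan (w / Gamma) - (2 Gamma / L_1^2) t].
   Along it [H_2] is a multiple of
     [sech (k t) ((21 L_1^2 - 25 Gamma^2 - 12 w^2) sin th + 20 Gamma w cos th)],
   [th = gamma^0 - (2 Gamma / L_1^2) t], and integrating by parts gives
   [melnikov = c L_1^5 (12 L_1^2 + 3/2 Gamma^2) S (nu) sin gamma^0], where [c <> 0],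
   [nu = Gamma / (2 W)] and [S] is the Fourier cosine transform of [sech].
   The Taylor coefficients of [S] are bounded uniformly over all centres, so [S] is
   analytic with radius at least 1 everywhere; hence if it vanished near one point it
   would vanish at 0, where it is positive. The amplitude is homogeneous of degree 7
   in [(L_1, Gamma)], so it is not constant. *)

(** * Analytic functions of two variables *)

(** The potential integrates along [separatrix], which is picked by [epsilon]: nothing can be
    computed before [is_separatrix] is known to have exactly one solution, so uniqueness matters as
    much as the explicit formula. The coordinate w suggests itself because sin^2 g_1 = G_1^2 /
    (G_1^2 + w^2) turns the curve into a conic in (w, G_1), while G_1 < L_1 becomes |w| < W, the
    interval between two rest points of the Riccati equation. Starting at g_1 = pi/2, that is w = 0,
    makes w odd in time; the part of the integrand carried by cos gamma^0 is then odd, which leaves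
    a real amplitude times sin gamma^0 and a purely imaginary L^+. The transform of sech has a
    closed form, usually found by residues. The proof stays within real analysis: non-vanishing
    somewhere in every open set is all that is asked of it, and continuation to the value at 0
    provides that. Analyticity is proved in a majorized form, since the convergence stated by
    [analytic_at] carries no bounds that could be passed to a composition. *)

Lemma tannery_null (d : nat -> nat -> R) (S : nat -> R) :
  (forall m N, Rabs (d m N) <= S m) -> ex_series S ->
  (forall m, is_lim_seq (d m) 0) ->
  is_lim_seq (fun N => sum_f_R0 (fun m => d m N) N) 0.
Proof.
  intros Hd [l Hl] Hlim.
  assert (Hfin : forall K, is_lim_seq (fun N => sum_f_R0 (fun m => d m N) K) 0).
  { induction K as [|K IH]; simpl.
    - apply Hlim.
    - replace (Finite 0) with (Finite (0 + 0)) by (f_equal; ring).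
      apply is_lim_seq_plus'; [exact IH | apply Hlim]. }
  (* Beyond rank [K] the sum is controlled by a slice of [S] whatever the inner index [N']. This
     uniformity allows the diagonal choice [N' = N], where the number of terms and the inner index
     grow together. *)
  assert (Htail : forall K N N', (K <= N)%nat ->
     Rabs (sum_f_R0 (fun m => d m N') N) <=
     Rabs (sum_f_R0 (fun m => d m N') K) + (sum_f_R0 S N - sum_f_R0 S K)).
  { intros K N N' HKN. induction HKN as [|N HKN IH]; simpl; [lra|].
    pose proof (Rabs_triang (sum_f_R0 (fun m => d m N') N) (d (Datatypes.S N) N')).
    pose proof (Hd (Datatypes.S N) N'). lra. }
  apply is_lim_seq_spec. intros eps.
  assert (Hl' : is_lim_seq (sum_n S) l) by exact Hl.
  apply is_lim_seq_spec in Hl'.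
  assert (He : 0 < eps / 4) by (pose proof (cond_pos eps); lra).
  destruct (Hl' (mkposreal _ He)) as [K HK]; simpl in HK.
  specialize (Hfin K). apply is_lim_seq_spec in Hfin.
  destruct (Hfin (mkposreal _ He)) as [N0 HN0]; simpl in HN0.
  exists (max K N0). intros N HN.
  assert (HKN : (K <= N)%nat) by lia.
  pose proof (Htail K N N HKN) as H1.
  assert (H2 := HN0 N ltac:(lia)).
  assert (H3 := HK N HKN). assert (H4 := HK K (le_n K)).
  rewrite !sum_n_Reals in H3. rewrite !sum_n_Reals in H4.
  rewrite Rminus_0_r in *.
  apply Rabs_def2 in H3. apply Rabs_def2 in H4. simpl in *. lra.
Qed.

Lemma sum_triangle (x : nat -> nat -> R) (N : nat) :
  (forall m n, (n < m)%nat -> x m n = 0) ->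
  sum_f_R0 (fun n => sum_f_R0 (fun m => x m n) n) N =
  sum_f_R0 (fun m => sum_f_R0 (fun n => x m n) N) N.
Proof.
  intros Hx. induction N as [|N IH]; [reflexivity|].
  rewrite tech5, IH.
  rewrite (sum_eq (fun m => sum_f_R0 (fun n => x m n) (S N))
     (fun m => sum_f_R0 (fun n => x m n) N + x m (S N))) by (intros; apply tech5).
  rewrite sum_plus, (tech5 (fun m => sum_f_R0 (fun n => x m n) N)).
  rewrite (sum_eq_R0 (fun n => x (S N) n)) by (intros; apply Hx; lia).
  ring.
Qed.

(** Exchange of summations under a majorant [y]. The rows vanish before the diagonal, so a
    triangular partial sum is also a square one; it differs from the partial sum of [T] by the row
    errors, each at most [2 * S m], and [tannery_null] sends their total to 0. *)
Lemma is_series_triangle (x y : nat -> nat -> R) (S T : nat -> R) (l : R) :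
  (forall m n, Rabs (x m n) <= y m n) ->
  (forall m n, (n < m)%nat -> x m n = 0) ->
  (forall m, is_series (y m) (S m)) -> ex_series S ->
  (forall m, is_series (x m) (T m)) -> is_series T l ->
  is_series (fun n => sum_f_R0 (fun m => x m n) n) l.
Proof.
  intros Hxy Hx Hy HS HT Hl.
  assert (HyN : forall m N, sum_f_R0 (y m) N <= S m).
  { intros m N. specialize (Hy m).
    apply is_lim_seq_incr_compare with (n := N) in Hy.
    - rewrite sum_n_Reals in Hy. exact Hy.
    - intros n. rewrite sum_Sn. unfold plus; simpl.
      pose proof (Hxy m (Datatypes.S n)). pose proof (Rabs_pos (x m (Datatypes.S n))). lra. }
  assert (HTS : forall m N, Rabs (sum_f_R0 (x m) N - T m) <= 2 * S m).
  { intros m N.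
    assert (HB : forall n, Rabs (sum_f_R0 (x m) n) <= S m).
    { intros n. eapply Rle_trans; [apply Rsum_abs|].
      eapply Rle_trans; [|apply (HyN m n)]. apply sum_Rle. intros; apply Hxy. }
    assert (HB2 : Rabs (T m) <= S m).
    { assert (Hc : is_lim_seq (fun n => Rabs (sum_f_R0 (x m) n)) (Rabs (T m))).
      { apply is_lim_seq_abs with (l := Finite (T m)).
        eapply is_lim_seq_ext; [|apply (HT m)]. intros n; apply sum_n_Reals. }
      apply (is_lim_seq_le _ _ _ _ HB Hc (is_lim_seq_const (S m))). }
    specialize (HB N). unfold Rminus.
    pose proof (Rabs_triang (sum_f_R0 (x m) N) (- T m)). rewrite Rabs_Ropp in H. lra. }
  assert (Hlim : is_lim_seq (fun N => sum_f_R0 (fun m => sum_f_R0 (x m) N - T m) N) 0).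
  { apply tannery_null with (S := fun m => 2 * S m).
    - exact HTS.
    - apply (ex_series_scal 2 S HS).
    - intros m. replace (Finite 0) with (Finite (T m - T m)) by (f_equal; ring).
      apply is_lim_seq_minus'; [|apply is_lim_seq_const].
      eapply is_lim_seq_ext; [|apply (HT m)]. intros n; apply sum_n_Reals. }
  assert (Hsum := is_lim_seq_plus' _ _ _ _ Hlim Hl).
  rewrite Rplus_0_l in Hsum.
  change (is_lim_seq (sum_n (fun n => sum_f_R0 (fun m => x m n) n)) l).
  eapply is_lim_seq_ext; [|apply Hsum]. intros N; simpl.
  rewrite !sum_n_Reals, sum_triangle by exact Hx.
  rewrite <- sum_plus. apply sum_eq. intros k _.
  change (sum_f_R0 (fun n => x k n) N) with (sum_f_R0 (x k) N). ring.
Qed.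

(* [M] bounds the sum of the absolute values of the coefficients. *)
Definition hpoly (n : nat) (P : R -> R -> R) (M : R) : Prop :=
  exists c : nat -> R,
    (forall u v, P u v = sum_f_R0 (fun k => c k * u ^ k * v ^ (n - k)) n) /\
    sum_f_R0 (fun k => Rabs (c k)) n <= M.

Lemma hpoly_ext n P Q M :
  (forall u v, P u v = Q u v) -> hpoly n P M -> hpoly n Q M.
Proof. intros H [c [Hc HM]]. exists c; split; [|exact HM]. intros; now rewrite <- H. Qed.

Lemma hpoly_pos n P M : hpoly n P M -> 0 <= M.
Proof.
  intros [c [_ HM]]. eapply Rle_trans; [|exact HM]. apply cond_pos_sum.
  intros; apply Rabs_pos.
Qed.

Lemma hpoly_zero n : hpoly n (fun _ _ => 0) 0.
Proof.
  exists (fun _ => 0); split.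
  - intros. rewrite sum_eq_R0; [reflexivity|]. intros; ring.
  - rewrite sum_eq_R0; [lra|]. intros; apply Rabs_R0.
Qed.

Lemma hpoly_const a : hpoly 0 (fun _ _ => a) (Rabs a).
Proof. exists (fun _ => a); split; intros; simpl; lra. Qed.

Lemma hpoly_plus n P Q M N :
  hpoly n P M -> hpoly n Q N -> hpoly n (fun u v => P u v + Q u v) (M + N).
Proof.
  intros [c [Hc HM]] [d [Hd HN]]. exists (fun k => c k + d k); split.
  - intros. rewrite Hc, Hd, <- sum_plus. apply sum_eq. intros; ring.
  - eapply Rle_trans; [apply sum_Rle; intros; apply Rabs_triang|].
    rewrite sum_plus. lra.
Qed.

Lemma hpoly_scal n a P M :
  hpoly n P M -> hpoly n (fun u v => a * P u v) (Rabs a * M).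
Proof.
  intros [c [Hc HM]]. exists (fun k => a * c k); split.
  - intros. rewrite Hc, scal_sum. apply sum_eq. intros; ring.
  - rewrite (sum_eq _ (fun k => Rabs (c k) * Rabs a)).
    + rewrite <- scal_sum. apply Rmult_le_compat_l; [apply Rabs_pos | exact HM].
    + intros. rewrite Rabs_mult; ring.
Qed.

Lemma hpoly_sum n (P : nat -> R -> R -> R) (M : nat -> R) N :
  (forall k, (k <= N)%nat -> hpoly n (P k) (M k)) ->
  hpoly n (fun u v => sum_f_R0 (fun k => P k u v) N) (sum_f_R0 M N).
Proof.
  induction N as [|N IH]; intros H; simpl; [apply H; lia|].
  apply hpoly_plus; [apply IH; intros; apply H; lia | apply H; lia].
Qed.

Lemma hpoly_mult_u n P M : hpoly n P M -> hpoly (S n) (fun u v => u * P u v) M.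
Proof.
  intros [c [Hc HM]].
  exists (fun k => match k with O => 0 | S k => c k end); split.
  - intros. rewrite (decomp_sum _ (S n)) by lia. simpl pred.
    rewrite Hc, scal_sum, Rmult_0_l, Rmult_0_l, Rplus_0_l.
    apply sum_eq. intros. simpl. ring.
  - rewrite (decomp_sum _ (S n)) by lia. simpl pred. rewrite Rabs_R0, Rplus_0_l.
    exact HM.
Qed.

Lemma hpoly_mult_v n P M : hpoly n P M -> hpoly (S n) (fun u v => v * P u v) M.
Proof.
  intros [c [Hc HM]].
  (* Nothing is known about [c] beyond [n], so the new top coefficient, that of [u ^ S n], has to be
     set to 0 explicitly. *)
  exists (fun k => if (k <=? n)%nat then c k else 0); split.
  - intros. rewrite tech5. rewrite (proj2 (Nat.leb_gt (S n) n)) by lia.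
    rewrite Hc, scal_sum, Rmult_0_l, Rmult_0_l, Rplus_0_r.
    apply sum_eq. intros k Hk. rewrite (proj2 (Nat.leb_le k n) Hk).
    replace (S n - k)%nat with (S (n - k)) by lia. simpl. ring.
  - rewrite tech5. rewrite (proj2 (Nat.leb_gt (S n) n)) by lia. rewrite Rabs_R0, Rplus_0_r.
    erewrite sum_eq; [exact HM|]. intros k Hk; cbn beta.
    now rewrite (proj2 (Nat.leb_le k n) Hk).
Qed.

Lemma hpoly_mult_monomial n k l P M :
  hpoly n P M -> hpoly (k + l + n) (fun u v => u ^ k * v ^ l * P u v) M.
Proof.
  intros H. induction k as [|k IHk].
  - induction l as [|l IHl].
    + apply hpoly_ext with (2 := H). intros; simpl; ring.
    + apply hpoly_ext with (2 := hpoly_mult_v _ _ _ IHl). intros; simpl; ring.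
  - apply hpoly_ext with (2 := hpoly_mult_u _ _ _ IHk). intros; simpl; ring.
Qed.

Lemma hpoly_le n P M M' : M <= M' -> hpoly n P M -> hpoly n P M'.
Proof. intros H [c [Hc HM]]. exists c; split; [exact Hc | lra]. Qed.

(** Expanding only [P] avoids a convolution of coefficients: a monomial times [Q] has the
    coefficients of [Q], shifted, hence the same norm, and the norms [Rabs (c k) * N] add up to at
    most [M * N]. *)
Lemma hpoly_mult n m P Q M N :
  hpoly n P M -> hpoly m Q N -> hpoly (n + m) (fun u v => P u v * Q u v) (M * N).
Proof.
  intros [c [Hc HM]] HQ.
  apply hpoly_le with (sum_f_R0 (fun k => Rabs (c k) * N) n).
  { rewrite <- scal_sum, Rmult_comm.
    apply Rmult_le_compat_r; [apply (hpoly_pos _ _ _ HQ) | exact HM]. }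
  apply hpoly_ext with
    (fun u v => sum_f_R0 (fun k => c k * (u ^ k * v ^ (n - k) * Q u v)) n).
  { intros. rewrite Hc, Rmult_comm, scal_sum. apply sum_eq. intros; ring. }
  apply hpoly_sum. intros k Hk. apply hpoly_scal.
  replace (n + m)%nat with (k + (n - k) + m)%nat by lia.
  apply hpoly_mult_monomial, HQ.
Qed.

Lemma hpoly_abs_bound n c M r u v :
  sum_f_R0 (fun k => Rabs (c k)) n <= M -> Rabs u <= r -> Rabs v <= r ->
  sum_f_R0 (fun k => Rabs (c k * u ^ k * v ^ (n - k))) n <= M * r ^ n.
Proof.
  intros HM Hu Hv.
  apply Rle_trans with (sum_f_R0 (fun k => Rabs (c k) * r ^ n) n).
  - apply sum_Rle. intros k Hk. rewrite !Rabs_mult, <- !RPow_abs.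
    replace (r ^ n) with (r ^ k * r ^ (n - k)) by (rewrite <- pow_add; f_equal; lia).
    rewrite Rmult_assoc. apply Rmult_le_compat_l; [apply Rabs_pos|].
    apply Rmult_le_compat; try (apply pow_le; apply Rabs_pos);
      apply pow_incr; split; try assumption; apply Rabs_pos.
  - rewrite <- scal_sum, Rmult_comm. apply Rmult_le_compat_r; [|exact HM].
    apply pow_le. pose proof (Rabs_pos u); lra.
Qed.

Lemma hpoly_bound n P M r u v :
  hpoly n P M -> Rabs u <= r -> Rabs v <= r -> Rabs (P u v) <= M * r ^ n.
Proof.
  intros [c [Hc HM]] Hu Hv. rewrite Hc.
  eapply Rle_trans; [apply Rsum_abs|]. now apply hpoly_abs_bound.
Qed.

(* Stronger than [analytic_at]: the coefficients are majorized on the closed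
   polydisc of radius [r], which makes the class stable under composition. *)
Definition hanalytic (f : R * R -> R) (p : R * R) : Prop :=
  exists (P : nat -> R -> R -> R) (M : nat -> R) (r : R), 0 < r /\
    (forall n, hpoly n (P n) (M n)) /\
    ex_series (fun n => M n * r ^ n) /\
    forall u v, Rabs u <= r -> Rabs v <= r ->
      is_series (fun n => P n u v) (f (fst p + u, snd p + v)).

Lemma hanalytic_analytic_at f p : hanalytic f p -> analytic_at f p.
Proof.
  intros [P [M [r [Hr [HP [HM Hf]]]]]].
  (* [hpoly] asserts coefficients degree by degree, while [analytic_at] wants a single array: choice
     selects them, and the entry (k, l) is read in degree k + l. *)
  assert (Hc : forall n, { c : nat -> R |
    (forall u v, P n u v = sum_f_R0 (fun k => c k * u ^ k * v ^ (n - k)) n) /\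
    sum_f_R0 (fun k => Rabs (c k)) n <= M n }).
  { intros n. apply constructive_indefinite_description, HP. }
  exists (fun k l => proj1_sig (Hc (k + l)%nat) k), r. split; [exact Hr|].
  intros x y Hx Hy.
  assert (Hmon : forall n k, (k <= n)%nat ->
    monomial2 (fun k l => proj1_sig (Hc (k + l)%nat) k) (x - fst p) (y - snd p) n k =
    proj1_sig (Hc n) k * (x - fst p) ^ k * (y - snd p) ^ (n - k)).
  { intros n k Hk. unfold monomial2. now replace (k + (n - k))%nat with n by lia. }
  split.
  - apply (@ex_series_le R_AbsRing R_CompleteNormedModule) with (2 := HM). intros n.
    rewrite sum_n_Reals.
    rewrite (sum_eq _ (fun k => Rabs (proj1_sig (Hc n) k * (x - fst p) ^ k * (y - snd p) ^ (n - k))))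
      by (intros; now rewrite Hmon).
    unfold norm; simpl; unfold abs; simpl. rewrite Rabs_pos_eq.
    + apply hpoly_abs_bound; try (apply Rlt_le; assumption).
      apply (proj2_sig (Hc n)).
    + apply cond_pos_sum. intros; apply Rabs_pos.
  - assert (Hs := Hf (x - fst p) (y - snd p) (Rlt_le _ _ Hx) (Rlt_le _ _ Hy)).
    replace (fst p + (x - fst p)) with x in Hs by ring.
    replace (snd p + (y - snd p)) with y in Hs by ring.
    eapply is_series_ext; [|exact Hs]. intros n; simpl.
    rewrite sum_n_Reals, (proj1 (proj2_sig (Hc n))).
    apply sum_eq. intros; now rewrite Hmon.
Qed.

Lemma ex_series_le_nonneg (a b : nat -> R) :
  (forall n, 0 <= a n <= b n) -> ex_series b -> ex_series a.
Proof.
  intros H. apply (@ex_series_le R_AbsRing R_CompleteNormedModule). intros n.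
  unfold norm; simpl; unfold abs; simpl. rewrite Rabs_pos_eq; apply H.
Qed.

Lemma is_series_nonneg (a : nat -> R) (l : R) :
  (forall n, 0 <= a n) -> is_series a l -> 0 <= l.
Proof.
  intros Ha Hl.
  apply (is_lim_seq_le (fun _ => 0) (sum_n a) 0 l); [|apply is_lim_seq_const | exact Hl].
  intros n. rewrite sum_n_Reals. now apply cond_pos_sum.
Qed.

Lemma is_series_Rmult_l (k : R) (a : nat -> R) (l : R) :
  is_series a l -> is_series (fun n => k * a n) (k * l).
Proof. exact (is_series_scal k a l). Qed.

Lemma majorant_shrink (M : nat -> R) r r' :
  (forall n, 0 <= M n) -> 0 < r' <= r ->
  ex_series (fun n => M n * r ^ n) -> ex_series (fun n => M n * r' ^ n).
Proof.
  intros HM Hr. apply ex_series_le_nonneg. intros n. split.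
  - apply Rmult_le_pos; [apply HM | apply pow_le; lra].
  - apply Rmult_le_compat_l; [apply HM | apply pow_incr; lra].
Qed.

Lemma is_series_finite_support (a : nat -> R) (N : nat) :
  (forall n, (N < n)%nat -> a n = 0) -> is_series a (sum_f_R0 a N).
Proof.
  intros H. change (is_lim_seq (sum_n a) (sum_f_R0 a N)).
  apply is_lim_seq_ext_loc with (fun _ => sum_f_R0 a N).
  - exists N. intros n Hn. rewrite sum_n_Reals.
    induction Hn as [|n Hn IH]; [reflexivity|]. simpl. rewrite <- IH, H by lia. ring.
  - apply is_lim_seq_const.
Qed.

Lemma is_series_first_term (a : nat -> R) (l : R) :
  (forall n, a (S n) = 0) -> a O = l -> is_series a l.
Proof.
  intros H <-. apply (is_series_finite_support a 0). intros [|n] Hn; [lia | apply H].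
Qed.

Lemma hanalytic_const a p : hanalytic (fun _ => a) p.
Proof.
  exists (fun n _ _ => match n with O => a | _ => 0 end),
    (fun n => match n with O => Rabs a | _ => 0 end), 1.
  repeat split; [lra | | |].
  - intros [|n]; [apply hpoly_const | apply hpoly_zero].
  - eexists. apply (is_series_finite_support _ 0). intros [|n] Hn; [lia | ring].
  - intros. apply (is_series_finite_support (fun n => match n with O => a | _ => 0 end) 0).
    intros [|n] Hn; [lia | ring].
Qed.

Lemma hanalytic_affine (f : R * R -> R) (P : R -> R -> R) p :
  hpoly 1 P 1 -> (forall u v, f (fst p + u, snd p + v) = f p + P u v) -> hanalytic f p.
Proof.
  intros HP Hf.
  exists (fun n u v => match n with O => f p | 1%nat => P u v | _ => 0 end),
    (fun n => match n with O => Rabs (f p) | 1%nat => 1 | _ => 0 end), 1.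
  repeat split; [lra | | |].
  - intros [|[|n]]; [apply hpoly_const | exact HP | apply hpoly_zero].
  - eexists. apply (is_series_finite_support _ 1). intros [|[|n]] Hn; [lia | lia | ring].
  - intros u v _ _. rewrite Hf.
    apply (is_series_finite_support (fun n => match n with O => f p | 1%nat => P u v | _ => 0 end) 1).
    intros [|[|n]] Hn; [lia | lia | ring].
Qed.

Lemma hanalytic_fst p : hanalytic fst p.
Proof.
  apply hanalytic_affine with (fun u _ => u); [|reflexivity].
  exists (fun k => match k with 1%nat => 1 | _ => 0 end); split; intros; simpl.
  - ring.
  - rewrite Rabs_R0, Rabs_R1. lra.
Qed.

Lemma hanalytic_snd p : hanalytic snd p.
Proof.
  apply hanalytic_affine with (fun _ v => v); [|reflexivity].
  exists (fun k => match k with 0%nat => 1 | _ => 0 end); split; intros; simpl.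
  - ring.
  - rewrite Rabs_R0, Rabs_R1. lra.
Qed.

Lemma hanalytic_plus f g p :
  hanalytic f p -> hanalytic g p -> hanalytic (fun q => f q + g q) p.
Proof.
  intros [P [M [r [Hr [HP [HM Hf]]]]]] [Q [N [s [Hs [HQ [HN Hg]]]]]].
  pose proof (Rmin_l r s). pose proof (Rmin_r r s).
  assert (0 < Rmin r s) by now apply Rmin_glb_lt.
  exists (fun n u v => P n u v + Q n u v), (fun n => M n + N n), (Rmin r s).
  repeat split; [assumption | | |].
  - intros; now apply hpoly_plus.
  - apply (ex_series_ext (fun n => plus (M n * Rmin r s ^ n) (N n * Rmin r s ^ n))).
    + intros; unfold plus; simpl; ring.
    + apply (ex_series_plus (fun n => M n * Rmin r s ^ n) (fun n => N n * Rmin r s ^ n)); [apply majorant_shrink with r | apply majorant_shrink with s];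
        try lra; try assumption; intros; eapply hpoly_pos; eauto.
  - intros u v Hu Hv. apply (is_series_plus (fun n => P n u v) (fun n => Q n u v)).
    + apply Hf; lra.
    + apply Hg; lra.
Qed.

Lemma cauchy_product_hpoly P Q M N n :
  (forall n, hpoly n (P n) (M n)) -> (forall n, hpoly n (Q n) (N n)) ->
  hpoly n (fun u v => sum_f_R0 (fun k => P k u v * Q (n - k)%nat u v) n)
    (sum_f_R0 (fun k => M k * N (n - k)%nat) n).
Proof.
  intros HP HQ. apply (hpoly_sum n (fun k u v => P k u v * Q (n - k)%nat u v)).
  intros k Hk. replace n with (k + (n - k))%nat at 1 by lia. now apply hpoly_mult.
Qed.

Lemma cauchy_product_majorant (M N : nat -> R) r n :
  sum_f_R0 (fun k => (M k * r ^ k) * (N (n - k)%nat * r ^ (n - k))) n =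
  sum_f_R0 (fun k => M k * N (n - k)%nat) n * r ^ n.
Proof.
  rewrite Rmult_comm, scal_sum. apply sum_eq. intros k Hk.
  replace (r ^ n) with (r ^ k * r ^ (n - k)) by (rewrite <- pow_add; f_equal; lia). ring.
Qed.

(** The majorants supply the absolute convergence of both factors that the Cauchy product
    requires. *)
Lemma majorized_product (P Q : nat -> R -> R -> R) (M N : nat -> R) r u v lP lQ lM lN :
  0 <= r -> Rabs u <= r -> Rabs v <= r ->
  (forall n, hpoly n (P n) (M n)) -> (forall n, hpoly n (Q n) (N n)) ->
  is_series (fun n => M n * r ^ n) lM -> is_series (fun n => N n * r ^ n) lN ->
  is_series (fun n => P n u v) lP -> is_series (fun n => Q n u v) lQ ->
  is_series (fun n => sum_f_R0 (fun k => P k u v * Q (n - k)%nat u v) n) (lP * lQ).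
Proof.
  intros Hr Hu Hv HP HQ HM HN HlP HlQ.
  apply (is_series_mult (fun n => P n u v) (fun n => Q n u v)); try assumption.
  - apply ex_series_le_nonneg with (2 := ex_intro _ _ HM).
    intros n. split; [apply Rabs_pos | now apply hpoly_bound].
  - apply ex_series_le_nonneg with (2 := ex_intro _ _ HN).
    intros n. split; [apply Rabs_pos | now apply hpoly_bound].
Qed.

Lemma majorant_product (M N : nat -> R) r lM lN :
  0 <= r -> (forall n, 0 <= M n) -> (forall n, 0 <= N n) ->
  is_series (fun n => M n * r ^ n) lM -> is_series (fun n => N n * r ^ n) lN ->
  is_series (fun n => sum_f_R0 (fun k => M k * N (n - k)%nat) n * r ^ n) (lM * lN).
Proof.
  intros Hr HM HN HlM HlN.
  eapply is_series_ext; [intros n; apply cauchy_product_majorant|].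
  apply (is_series_mult (fun n => M n * r ^ n) (fun n => N n * r ^ n)); try assumption.
  - apply ex_series_ext with (fun n => M n * r ^ n); [|eexists; exact HlM].
    intros n. rewrite Rabs_pos_eq; [reflexivity|]. apply Rmult_le_pos; [apply HM | now apply pow_le].
  - apply ex_series_ext with (fun n => N n * r ^ n); [|eexists; exact HlN].
    intros n. rewrite Rabs_pos_eq; [reflexivity|]. apply Rmult_le_pos; [apply HN | now apply pow_le].
Qed.

Lemma hanalytic_mult f g p :
  hanalytic f p -> hanalytic g p -> hanalytic (fun q => f q * g q) p.
Proof.
  intros [P [M [r [Hr [HP [HM Hf]]]]]] [Q [N [s [Hs [HQ [HN Hg]]]]]].
  pose proof (Rmin_l r s). pose proof (Rmin_r r s).
  assert (0 < Rmin r s) by now apply Rmin_glb_lt.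
  assert (HM0 : forall n, 0 <= M n) by (intros; eapply hpoly_pos; eauto).
  assert (HN0 : forall n, 0 <= N n) by (intros; eapply hpoly_pos; eauto).
  apply majorant_shrink with (r' := Rmin r s) in HM; [|assumption|lra].
  apply majorant_shrink with (r' := Rmin r s) in HN; [|assumption|lra].
  destruct HM as [lM HM]. destruct HN as [lN HN].
  eexists _, _, (Rmin r s). split; [assumption|]. split.
  - intros n. apply (cauchy_product_hpoly P Q M N n HP HQ).
  - split.
    + eexists. apply majorant_product; eauto; lra.
    + intros u v Hu Hv. apply (majorized_product P Q M N (Rmin r s) u v _ _ lM lN); try assumption; try lra.
      * apply Hf; lra.
      * apply Hg; lra.
Qed.

Lemma hanalytic_pow f p n : hanalytic f p -> hanalytic (fun q => f q ^ n) p.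
Proof.
  intros H. induction n as [|n IH]; simpl; [apply hanalytic_const|].
  now apply hanalytic_mult.
Qed.

(** * Composition with analytic functions of one variable *)

(** The geometric bound on the coefficients makes the series converge absolutely for
    [Rabs h * M < 1]; the composition uses this absolute convergence. *)
Definition analytic1 (f : R -> R) (x : R) : Prop :=
  exists (c : nat -> R) (C M : R), 0 < M /\
    (forall k, Rabs (c k) <= C * M ^ k) /\
    forall h, Rabs h * M < 1 -> is_series (fun k => c k * h ^ k) (f (x + h)).

(** The coefficient of X^n in the m-th power of the formal series with coefficients [a]. *)
Fixpoint cauchy_pow (a : nat -> R) (m n : nat) : R :=
  match m with
  | O => match n with O => 1 | _ => 0 end
  | S m => sum_f_R0 (fun k => a k * cauchy_pow a m (n - k)) n
  end.

Lemma cauchy_pow_order a m n : a O = 0 -> (n < m)%nat -> cauchy_pow a m n = 0.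
Proof.
  intros Ha. revert n. induction m as [|m IH]; intros n Hn; [lia|]. simpl.
  apply sum_eq_R0. intros [|k] Hk; [rewrite Ha; ring|]. rewrite IH by lia. ring.
Qed.

Lemma cauchy_pow_hpoly P M m n :
  (forall n, hpoly n (P n) (M n)) ->
  hpoly n (fun u v => cauchy_pow (fun k => P k u v) m n) (cauchy_pow M m n).
Proof.
  intros HP. revert n. induction m as [|m IH]; intros n; simpl.
  - destruct n; [|apply hpoly_zero]. apply hpoly_le with (2 := hpoly_const 1). rewrite Rabs_R1; lra.
  - apply (cauchy_product_hpoly P (fun n u v => cauchy_pow (fun k => P k u v) m n)); auto.
Qed.

Lemma cauchy_pow_majorant M r lM m :
  0 <= r -> (forall n, 0 <= M n) -> is_series (fun n => M n * r ^ n) lM ->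
  (forall n, 0 <= cauchy_pow M m n) /\
  is_series (fun n => cauchy_pow M m n * r ^ n) (lM ^ m).
Proof.
  intros Hr HM HlM. induction m as [|m [IH1 IH2]]; simpl.
  - split; [intros [|n]; lra|].
    apply is_series_first_term; intros; simpl; ring.
  - split.
    + intros n. apply cond_pos_sum. intros; now apply Rmult_le_pos.
    + now apply majorant_product.
Qed.

Lemma cauchy_pow_series P M r lM u v l m :
  0 <= r -> Rabs u <= r -> Rabs v <= r ->
  (forall n, hpoly n (P n) (M n)) -> is_series (fun n => M n * r ^ n) lM ->
  is_series (fun n => P n u v) l ->
  is_series (cauchy_pow (fun k => P k u v) m) (l ^ m).
Proof.
  intros Hr Hu Hv HP HM Hl.
  assert (HM0 : forall n, 0 <= M n) by (intros; eapply hpoly_pos; eauto).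
  induction m as [|m IH]; simpl.
  - apply is_series_first_term; reflexivity.
  - apply (majorized_product P (fun n u v => cauchy_pow (fun k => P k u v) m n)
      M (cauchy_pow M m) r u v l (l ^ m) lM (lM ^ m)); try assumption.
    + intros n. now apply cauchy_pow_hpoly.
    + now apply (cauchy_pow_majorant M r lM m).
Qed.

Lemma ex_series_geom_bound (c : nat -> R) C M s :
  0 <= s -> 0 < M -> s * M < 1 -> (forall k, Rabs (c k) <= C * M ^ k) ->
  ex_series (fun k => Rabs (c k) * s ^ k).
Proof.
  intros Hs HM HsM Hc.
  apply ex_series_le_nonneg with (fun k => scal C ((s * M) ^ k)).
  - intros k. split; [apply Rmult_le_pos; [apply Rabs_pos | now apply pow_le]|].
    unfold scal; simpl; unfold mult; simpl. rewrite Rpow_mult_distr.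
    replace (C * (s ^ k * M ^ k)) with (C * M ^ k * s ^ k) by ring.
    apply Rmult_le_compat_r; [now apply pow_le | apply Hc].
  - apply (ex_series_scal C (fun k => (s * M) ^ k)). eexists. apply is_series_geom.
    rewrite Rabs_pos_eq; [exact HsM|]. apply Rmult_le_pos; lra.
Qed.

(* The increment of [g] has no constant term, so its [m]-th power starts in
   degree [m] and the composed coefficients are finite sums. *)
Lemma hanalytic_comp (f : R -> R) (g : R * R -> R) p :
  hanalytic g p -> analytic1 f (g p) -> hanalytic (fun q => f (g q)) p.
Proof.
  intros [P [M [r [Hr [HP [HM Hg]]]]]] [c [C [K [HK [Hc Hf]]]]].
  assert (HM0 : forall n, 0 <= M n) by (intros; eapply hpoly_pos; eauto).
  set (P' := fun (n : nat) u v => match n with O => 0 | _ => P n u v end).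
  set (M' := fun n : nat => match n with O => 0 | _ => M n end).
  assert (HP' : forall n, hpoly n (P' n) (M' n)).
  { intros [|n]; [apply hpoly_zero | apply HP]. }
  assert (HM'0 : forall n, 0 <= M' n) by (intros; eapply hpoly_pos; eauto).
  (* At the origin every term of positive degree vanishes by its own bound, so the constant [P O] is
     the value of [g] at [p]. *)
  assert (HgP : forall u v, P O u v = g p).
  { assert (H0 : is_series (fun n => P n 0 0) (g p)).
    { replace (g p) with (g (fst p + 0, snd p + 0))
        by (rewrite !Rplus_0_r; now destruct p).
      apply Hg; rewrite Rabs_R0; lra. }
    assert (H1 : is_series (fun n => P n 0 0) (P O 0 0)).
    { apply (is_series_finite_support (fun n => P n 0 0) 0). intros [|n] Hn; [lia|].
      assert (Hb := hpoly_bound _ _ _ 0 0 0 (HP (S n))).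
      rewrite Rabs_R0 in Hb. specialize (Hb (Rle_refl 0) (Rle_refl 0)).
      rewrite pow_i, Rmult_0_r in Hb by lia.
      pose proof (Rabs_pos (P (S n) 0 0)).
      destruct (Req_dec (P (S n) 0 0) 0) as [E|E]; [exact E|].
      apply Rabs_pos_lt in E. lra. }
    intros u v. rewrite <- (is_series_unique _ _ H0), (is_series_unique _ _ H1).
    destruct (HP O) as [a [Ha _]]. rewrite !Ha. simpl. ring. }
  assert (Hinc : forall u v, Rabs u <= r -> Rabs v <= r ->
    is_series (fun n => P' n u v) (g (fst p + u, snd p + v) - g p)).
  { intros u v Hu Hv.
    apply is_series_decr_1. apply is_series_ext with (fun n => P (S n) u v); [reflexivity|].
    replace (plus _ _) with (plus (g (fst p + u, snd p + v)) (opp (P O u v))).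
    - apply (is_series_incr_1 (fun n => P n u v)).
      replace (plus _ _) with (g (fst p + u, snd p + v)); [now apply Hg|].
      unfold plus, opp; simpl; ring.
    - rewrite HgP. unfold plus, opp; simpl; ring. }
  assert (HM' : ex_series (fun n => M' n * r ^ n)).
  { apply ex_series_le_nonneg with (2 := HM). intros [|n]; simpl.
    - specialize (HM0 O). lra.
    - split; [|lra]. apply Rmult_le_pos; [apply HM0|].
      apply Rmult_le_pos; [lra | apply pow_le; lra]. }
  destruct HM' as [B HB].
  assert (HB0 : 0 <= B).
  { apply is_series_nonneg with (2 := HB). intros n.
    apply Rmult_le_pos; [apply HM'0 | apply pow_le; lra]. }
  (* Having no constant term, the majorant shrinks at least linearly: at [rho] it is at most
     [rho / r * B], and this must fall below [/ K] for the increment to stay where the series of [f]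
     converges. The added 1 in the witness keeps [rho <= r] and covers [B = 0]. *)
  assert (Hrho : exists rho, 0 < rho <= r /\ rho / r * B * K < 1).
  { exists (r * / (1 + B * K)).
    assert (0 <= B * K) by (apply Rmult_le_pos; lra).
    assert (Hi : 0 < / (1 + B * K)) by (apply Rinv_0_lt_compat; lra).
    assert (Hi1 : / (1 + B * K) * (1 + B * K) = 1) by (field; lra).
    split; [split; [now apply Rmult_lt_0_compat|]|].
    - rewrite <- (Rmult_1_r r) at 2. apply Rmult_le_compat_l; [lra|]. nra.
    - replace (r * / (1 + B * K) / r * B * K) with (/ (1 + B * K) * (B * K)) by (field; lra).
      nra. }
  destruct Hrho as [rho [[Hrho Hrr] HrB]].
  assert (Hsig : exists s, is_series (fun n => M' n * rho ^ n) s /\ 0 <= s /\ s * K < 1).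
  { assert (Hle : forall n, 0 <= M' n * rho ^ n <= rho / r * (M' n * r ^ n)).
    { intros n. split; [apply Rmult_le_pos; [apply HM'0 | apply pow_le; lra]|].
      destruct n as [|n]; [simpl; lra|].
      replace (rho / r * (M' (S n) * r ^ S n)) with (M' (S n) * (rho * r ^ n))
        by (simpl; field; lra).
      apply Rmult_le_compat_l; [apply HM'0|]. simpl.
      apply Rmult_le_compat_l; [lra|]. apply pow_incr; lra. }
    assert (Hscal := is_series_scal (rho / r) _ _ HB).
    assert (Hex : ex_series (fun n => M' n * rho ^ n)).
    { apply ex_series_le_nonneg with (1 := Hle). eexists; exact Hscal. }
    exists (Series (fun n => M' n * rho ^ n)). split; [now apply Series_correct|].
    assert (Hs : Series (fun n => M' n * rho ^ n) <= rho / r * B).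
    { eapply Rle_trans; [apply (Series_le _ _ Hle); eexists; exact Hscal|].
      right. apply (is_series_unique _ _ Hscal). }
    split.
    - apply is_series_nonneg with (2 := Series_correct _ Hex). intros n; apply Hle.
    - apply Rle_lt_trans with (2 := HrB). apply Rmult_le_compat_r; lra. }
  destruct Hsig as [s [Hs [Hs0 HsK]]].
  assert (Hpow := fun m => cauchy_pow_majorant M' rho s m (Rlt_le _ _ Hrho) HM'0 Hs).
  assert (HcS : ex_series (fun m => Rabs (c m) * s ^ m)) by now apply (ex_series_geom_bound c C K).
  exists (fun n u v => sum_f_R0 (fun m => c m * cauchy_pow (fun k => P' k u v) m n) n),
    (fun n => sum_f_R0 (fun m => Rabs (c m) * cauchy_pow M' m n) n), rho.
  repeat split; [exact Hrho | | |].
  - intros n.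
    apply (hpoly_sum n (fun m u v => c m * cauchy_pow (fun k => P' k u v) m n)).
    intros m _. apply hpoly_scal. now apply cauchy_pow_hpoly.
  - exists (Series (fun m => Rabs (c m) * s ^ m)).
    apply is_series_ext with
      (fun n => sum_f_R0 (fun m => Rabs (c m) * (cauchy_pow M' m n * rho ^ n)) n).
    { intros n. rewrite (Rmult_comm _ (rho ^ n)), scal_sum. apply sum_eq. intros; ring. }
    apply is_series_triangle with
      (y := fun m n => Rabs (c m) * (cauchy_pow M' m n * rho ^ n))
      (S := fun m => Rabs (c m) * s ^ m) (T := fun m => Rabs (c m) * s ^ m).
    + intros m n. rewrite Rabs_pos_eq; [lra|].
      apply Rmult_le_pos; [apply Rabs_pos|]. apply Rmult_le_pos; [apply Hpow | apply pow_le; lra].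
    + intros m n Hmn. rewrite cauchy_pow_order; [ring | reflexivity | exact Hmn].
    + intros m. apply is_series_Rmult_l, Hpow.
    + exact HcS.
    + intros m. apply is_series_Rmult_l, Hpow.
    + now apply Series_correct.
  - intros u v Hu Hv.
    set (d := g (fst p + u, snd p + v) - g p).
    assert (Hd : is_series (fun n => P' n u v) d) by (apply Hinc; lra).
    assert (Hds : Rabs d <= s).
    { assert (Hb : forall n, 0 <= Rabs (P' n u v) <= M' n * rho ^ n)
        by (intros; split; [apply Rabs_pos | now apply hpoly_bound]).
      rewrite <- (is_series_unique _ _ Hd), <- (is_series_unique _ _ Hs).
      eapply Rle_trans; [apply Series_Rabs|].
      - apply ex_series_le_nonneg with (1 := Hb). eexists; exact Hs.
      - apply Series_le; [exact Hb | eexists; exact Hs]. }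
    replace (g (fst p + u, snd p + v)) with (g p + d) by (unfold d; ring).
    apply is_series_triangle with
      (y := fun m n => Rabs (c m) * (cauchy_pow M' m n * rho ^ n))
      (S := fun m => Rabs (c m) * s ^ m) (T := fun m => c m * d ^ m).
    + intros m n. rewrite Rabs_mult. apply Rmult_le_compat_l; [apply Rabs_pos|].
      apply (hpoly_bound n (fun u v => cauchy_pow (fun k => P' k u v) m n)); try assumption.
      now apply cauchy_pow_hpoly.
    + intros m n Hmn. rewrite cauchy_pow_order; [ring | reflexivity | exact Hmn].
    + intros m. apply is_series_Rmult_l, Hpow.
    + exact HcS.
    + intros m. apply is_series_Rmult_l.
      apply (cauchy_pow_series P' M' rho s u v d m); try assumption; lra.
    + apply Hf. apply Rle_lt_trans with (2 := HsK). apply Rmult_le_compat_r; lra.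
Qed.

(** * Fourier transform of the hyperbolic secant *)

Lemma INR_fact_pos n : 0 < INR (fact n).
Proof. apply lt_0_INR, lt_O_fact. Qed.

Lemma INR_fact_S n : INR (fact (S n)) = INR (S n) * INR (fact n).
Proof. rewrite fact_simpl. apply mult_INR. Qed.

Lemma is_derive_Rconst (a x : R) : is_derive (fun _ : R => a) x 0.
Proof. exact (is_derive_const a x). Qed.

Lemma is_derive_pow_fact n t :
  is_derive (fun t => t ^ S n / INR (fact (S n))) t (t ^ n / INR (fact n)).
Proof.
  rewrite INR_fact_S. pose proof (INR_fact_pos n).
  assert (INR (S n) <> 0) by (apply not_0_INR; lia).
  set (m := S n) in *. auto_derive; [exact I|]. change (pred m) with n.
  field. split; [lra | assumption].
Qed.

Lemma is_derive_taylor_poly (a : nat -> R) N t :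
  is_derive (fun t => sum_f_R0 (fun k => a k * (t ^ k / INR (fact k))) (S N)) t
    (sum_f_R0 (fun k => a (S k) * (t ^ k / INR (fact k))) N).
Proof.
  assert (Hterm : forall n, is_derive (fun t => a (S n) * (t ^ S n / INR (fact (S n)))) t
                     (a (S n) * (t ^ n / INR (fact n)))).
  { intros n. apply is_derive_scal, is_derive_pow_fact. }
  induction N as [|N IH].
  - apply (is_derive_ext (fun t => a O + a 1%nat * (t ^ 1 / INR (fact 1)))).
    + intros; simpl; field.
    + replace (sum_f_R0 _ 0) with (0 + a 1%nat * (t ^ 0 / INR (fact 0))) by (simpl; ring).
      apply (is_derive_plus (fun _ => a O)); [apply is_derive_Rconst | apply Hterm].
  - rewrite tech5.
    apply (is_derive_plus (fun t => sum_f_R0 (fun k => a k * (t ^ k / INR (fact k))) (S N))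
      (fun t => a (S (S N)) * (t ^ S (S N) / INR (fact (S (S N)))))); [exact IH | apply Hterm].
Qed.

Lemma nonneg_of_derive (q dq : R -> R) t :
  (forall s, 0 <= s <= t -> is_derive q s (dq s)) ->
  (forall s, 0 <= s <= t -> 0 <= dq s) -> 0 <= t -> 0 <= q 0 -> 0 <= q t.
Proof.
  intros Hq Hdq Ht Hq0.
  destruct (MVT_gen q 0 t dq) as [c [Hc Heq]]; try rewrite Rmin_left, Rmax_right in * by lra.
  - intros; apply Hq; lra.
  - intros x Hx. apply continuity_pt_filterlim, (ex_derive_continuous q).
    eexists; apply Hq; lra.
  - rewrite Rminus_0_r in Heq. specialize (Hdq c Hc).
    assert (0 <= dq c * t) by now apply Rmult_le_pos. lra.
Qed.

(** The monomial bound plus [r], and the same bound minus [r], both vanish at 0 and have a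
    nonnegative derivative. *)
Lemma growth_bound (r dr : R -> R) C m t :
  (forall s, 0 <= s <= t -> is_derive r s (dr s)) ->
  (forall s, 0 <= s <= t -> Rabs (dr s) <= C * (s ^ m / INR (fact m))) ->
  0 <= t -> r 0 = 0 -> Rabs (r t) <= C * (t ^ S m / INR (fact (S m))).
Proof.
  intros Hr Hdr Ht Hr0.
  assert (H0 : C * (0 ^ S m / INR (fact (S m))) = 0)
    by (rewrite pow_i by lia; unfold Rdiv; ring).
  assert (Hd : forall s, 0 <= s <= t -> forall e,
    is_derive (fun s => C * (s ^ S m / INR (fact (S m))) + e * r s) s
      (C * (s ^ m / INR (fact m)) + e * dr s)).
  { intros s Hs e. apply (is_derive_plus (fun s => C * (s ^ S m / INR (fact (S m))))).
    - apply is_derive_scal, is_derive_pow_fact.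
    - apply is_derive_scal, Hr, Hs. }
  apply Rabs_le. split.
  - assert (H : 0 <= C * (t ^ S m / INR (fact (S m))) + 1 * r t); [|lra].
    apply (nonneg_of_derive _ _ t (fun s Hs => Hd s Hs 1)); try assumption.
    + intros s Hs. specialize (Hdr s Hs). apply Rabs_le_between in Hdr. lra.
    + cbv beta. rewrite H0, Hr0. lra.
  - assert (H : 0 <= C * (t ^ S m / INR (fact (S m))) + (-1) * r t); [|lra].
    apply (nonneg_of_derive _ _ t (fun s Hs => Hd s Hs (-1))); try assumption.
    + intros s Hs. specialize (Hdr s Hs). apply Rabs_le_between in Hdr. lra.
    + cbv beta. rewrite H0, Hr0. lra.
Qed.

(** The induction runs over all families [phi] at once: the derivative of the remainder of [phi O]
    at order [S N] is the remainder at order [N] of the shifted family, and [growth_bound]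
    integrates that estimate. *)
Lemma taylor_bound_unit N : forall (phi : nat -> R -> R) C,
  (forall n t, 0 <= t <= 1 -> is_derive (phi n) t (phi (S n) t)) ->
  (forall t, 0 <= t <= 1 -> Rabs (phi (S N) t) <= C) ->
  forall t, 0 <= t <= 1 ->
  Rabs (phi O t - sum_f_R0 (fun k => phi k 0 * (t ^ k / INR (fact k))) N)
    <= C * (t ^ S N / INR (fact (S N))).
Proof.
  induction N as [|N IH]; intros phi C Hd HC t Ht.
  - apply (growth_bound (fun t => phi O t - phi O 0 * (t ^ 0 / INR (fact 0))) (phi 1%nat)).
    + intros s Hs. apply (is_derive_ext (fun s => phi O s - phi O 0)).
      { intros; simpl; field. }
      rewrite <- (Rminus_0_r (phi 1%nat s)).
      apply (is_derive_minus (phi O) (fun _ => phi O 0)); [apply Hd; lra | apply is_derive_Rconst].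
    + intros s Hs. simpl. replace (C * (1 / 1)) with C by field. apply HC; lra.
    + lra.
    + simpl; field.
  - apply (growth_bound
      (fun t => phi O t - sum_f_R0 (fun k => phi k 0 * (t ^ k / INR (fact k))) (S N))
      (fun t => phi 1%nat t - sum_f_R0 (fun k => phi (S k) 0 * (t ^ k / INR (fact k))) N)).
    + intros s Hs. apply (is_derive_minus (phi O)); [apply Hd; lra|].
      apply (is_derive_taylor_poly (fun k => phi k 0)).
    + intros s Hs. apply (IH (fun n => phi (S n))); [intros; now apply Hd | exact HC | lra].
    + lra.
    + rewrite (decomp_sum _ (S N)) by lia.
      rewrite sum_eq_R0; [simpl; field|]. intros. rewrite pow_i by lia. unfold Rdiv; ring.
Qed.

Lemma taylor_bound (F : nat -> R -> R) x h C N :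
  (forall n y, Rabs (y - x) <= Rabs h -> is_derive (F n) y (F (S n) y)) ->
  (forall y, Rabs (y - x) <= Rabs h -> Rabs (F (S N) y) <= C) ->
  Rabs (F O (x + h) - sum_f_R0 (fun k => F k x / INR (fact k) * h ^ k) N)
    <= C * (Rabs h ^ S N / INR (fact (S N))).
Proof.
  intros Hd HC.
  assert (Hseg : forall t, 0 <= t <= 1 -> Rabs (x + t * h - x) <= Rabs h).
  { intros t Ht. replace (x + t * h - x) with (t * h) by ring.
    rewrite Rabs_mult, (Rabs_pos_eq t) by lra. pose proof (Rabs_pos h). nra. }
  (* Restricting to the segment from [x] to [x + h], run through by [t] in [0, 1], treats both signs
     of [h] together; the chain rule produces the factor [h ^ n]. *)
  assert (Hu := taylor_bound_unit N (fun n t => h ^ n * F n (x + t * h)) (Rabs h ^ S N * C)).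
  assert (H1 : 0 <= 1 <= 1) by lra.
  specialize (fun H H' => Hu H H' 1 H1).
  rewrite pow1 in Hu. cbv beta in Hu.
  replace (C * (Rabs h ^ S N / INR (fact (S N)))) with
    (Rabs h ^ S N * C * (1 / INR (fact (S N)))) by (unfold Rdiv; ring).
  replace (F O (x + h) - _) with
    (h ^ 0 * F O (x + 1 * h) -
     sum_f_R0 (fun k => h ^ k * F k (x + 0 * h) * (1 ^ k / INR (fact k))) N).
  - apply Hu.
    + intros n t Ht.
      apply (is_derive_ext (fun t => h ^ n * F n (x + t * h))); [reflexivity|].
      replace (h ^ S n * F (S n) (x + t * h)) with (h ^ n * (h * F (S n) (x + t * h)))
        by (simpl; ring).
      apply is_derive_scal.
      apply (is_derive_comp (F n) (fun t => x + t * h)).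
      * apply Hd, Hseg, Ht.
      * auto_derive; [exact I | unfold scal; simpl; unfold mult; simpl; ring].
    + intros t Ht. rewrite Rabs_mult, <- RPow_abs.
      apply Rmult_le_compat_l; [apply pow_le, Rabs_pos | apply HC, Hseg, Ht].
  - replace (1 * h) with h by ring. f_equal; [simpl; ring|]. apply sum_eq. intros k _.
    rewrite pow1, Rmult_0_l, Rplus_0_r. unfold Rdiv; ring.
Qed.

Lemma is_series_of_geom_remainder (a : nat -> R) l C q :
  Rabs q < 1 -> (forall N, Rabs (l - sum_f_R0 a N) <= C * q ^ S N) -> is_series a l.
Proof.
  intros Hq H. change (is_lim_seq (sum_n a) l).
  assert (Hz : is_lim_seq (fun N => C * q ^ S N) 0).
  { replace (Finite 0) with (Rbar_mult C 0) by (simpl; f_equal; ring).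
    apply is_lim_seq_scal_l. apply (is_lim_seq_incr_1 (fun N => q ^ N)).
    now apply is_lim_seq_geom. }
  assert (Hd : is_lim_seq (fun N => sum_f_R0 a N - l) 0).
  { apply is_lim_seq_abs_0.
    apply is_lim_seq_le_le with (u := fun _ => 0) (w := fun N => C * q ^ S N).
    - intros N. split; [apply Rabs_pos|]. rewrite Rabs_minus_sym. apply H.
    - apply is_lim_seq_const.
    - exact Hz. }
  assert (Hs := is_lim_seq_plus' _ _ _ _ Hd (is_lim_seq_const l)).
  rewrite Rplus_0_l in Hs. eapply is_lim_seq_ext; [|exact Hs].
  intros N; simpl. rewrite sum_n_Reals. ring.
Qed.

(** The condition [1 <= M * delta] puts the disc [Rabs h * M < 1] inside the interval where the
    derivatives are controlled. The factorial allowed in their growth cancels the one in Taylor's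
    formula, which leaves a geometric remainder. *)
Lemma analytic1_of_derivatives (F : nat -> R -> R) x C M delta :
  0 < M -> 1 <= M * delta ->
  (forall n y, Rabs (y - x) <= delta -> is_derive (F n) y (F (S n) y)) ->
  (forall n y, Rabs (y - x) <= delta -> Rabs (F n y) <= C * M ^ n * INR (fact n)) ->
  analytic1 (F O) x.
Proof.
  intros HM Hdel Hd HC. exists (fun k => F k x / INR (fact k)), C, M.
  split; [exact HM|]. split.
  - intros k. pose proof (INR_fact_pos k). unfold Rdiv. rewrite Rabs_mult, Rabs_inv.
    rewrite (Rabs_pos_eq (INR _)) by lra.
    apply Rmult_le_reg_r with (INR (fact k)); [assumption|].
    rewrite Rmult_assoc, Rinv_l, Rmult_1_r by lra. apply HC.
    rewrite Rminus_diag, Rabs_R0. nra.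
  - intros h Hh.
    assert (Hhd : Rabs h <= delta) by (pose proof (Rabs_pos h); nra).
    apply is_series_of_geom_remainder with C (Rabs h * M).
    { rewrite Rabs_pos_eq; [exact Hh|]. apply Rmult_le_pos; [apply Rabs_pos | lra]. }
    intros N. eapply Rle_trans.
    + apply taylor_bound with (C := C * M ^ S N * INR (fact (S N))).
      * intros; apply Hd; lra.
      * intros; apply HC; lra.
    + right. rewrite Rpow_mult_distr. pose proof (INR_fact_pos (S N)). field. lra.
Qed.

(** The n-th derivative of [/ sqrt y] is [inv_sqrt_coef n / (sqrt y * y ^ n)]. *)
Fixpoint inv_sqrt_coef (n : nat) : R :=
  match n with O => 1 | S n => - (INR n + / 2) * inv_sqrt_coef n end.

Lemma inv_sqrt_coef_bound n : Rabs (inv_sqrt_coef n) <= INR (fact n).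
Proof.
  induction n as [|n IH]; [simpl; rewrite Rabs_R1; lra|].
  rewrite INR_fact_S. simpl inv_sqrt_coef. rewrite Rabs_mult, Rabs_Ropp.
  pose proof (pos_INR n). rewrite (Rabs_pos_eq (INR n + / 2)) by lra.
  apply Rmult_le_compat; try apply Rabs_pos; try lra. rewrite S_INR. lra.
Qed.

Lemma analytic1_inv_sqrt x : 0 < x -> analytic1 (fun y => / sqrt y) x.
Proof.
  intros Hx.
  assert (Hsx : 0 < sqrt (x / 2)) by (apply sqrt_lt_R0; lra).
  (* Within distance [x / 2] of [x] each factor [/ y] costs at most [2 / x]; taking [M = 2 / x] and
     [delta = x / 2] gives [M * delta = 1]. *)
  assert (Hy : forall y, Rabs (y - x) <= x / 2 -> x / 2 <= y).
  { intros y H. apply Rabs_le_between in H. lra. }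
  assert (Ha : analytic1 (fun y => inv_sqrt_coef O / (sqrt y * y ^ 0)) x).
  { apply (analytic1_of_derivatives (fun n y => inv_sqrt_coef n / (sqrt y * y ^ n)) x
      (/ sqrt (x / 2)) (2 / x) (x / 2)).
    - apply Rdiv_lt_0_compat; lra.
    - right; field; lra.
    - intros n y H. specialize (Hy y H).
      assert (Hsy : 0 < sqrt y) by (apply sqrt_lt_R0; lra).
      assert (Hyn : 0 < y ^ n) by (apply pow_lt; lra).
      auto_derive.
      + repeat split; [lra | nra].
      + simpl inv_sqrt_coef.
        assert (Hss : sqrt y * sqrt y = y) by (apply sqrt_sqrt; lra).
        destruct n as [|n].
        * simpl. set (s := sqrt y) in *. rewrite <- Hss. field. lra.
        * assert (Hyn' : 0 < y ^ n) by (apply pow_lt; lra).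
          change (y ^ S n) with (y * y ^ n) in *. simpl pred.
          change (y ^ S (S n)) with (y * (y * y ^ n)).
          set (z := y ^ n) in *. set (s := sqrt y) in *. clearbody z s. rewrite <- Hss. field. split; lra.
    - intros n y H. specialize (Hy y H).
      assert (Hsy : sqrt (x / 2) <= sqrt y) by (apply sqrt_le_1_alt; lra).
      assert (Hyn : 0 < y ^ n) by (apply pow_lt; lra).
      unfold Rdiv at 1. rewrite Rabs_mult, Rabs_inv.
      rewrite (Rabs_pos_eq (sqrt y * y ^ n)) by (apply Rmult_le_pos; lra).
      rewrite Rinv_mult.
      rewrite Rmult_comm. apply Rmult_le_compat.
      + apply Rmult_le_pos; left; apply Rinv_0_lt_compat; lra.
      + apply Rabs_pos.
      + apply Rmult_le_compat; try (left; apply Rinv_0_lt_compat; lra).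
        * apply Rinv_le_contravar; lra.
        * rewrite <- pow_inv. apply pow_incr. split; [left; apply Rinv_0_lt_compat; lra|].
          replace (2 / x) with (/ (x / 2)) by (field; lra). apply Rinv_le_contravar; lra.
      + apply inv_sqrt_coef_bound. }
  destruct Ha as [c [C [M [HM [Hc Hs]]]]]. exists c, C, M. repeat split; try assumption.
  intros h Hh. specialize (Hs h Hh). cbv beta in Hs.
  replace (/ sqrt (x + h)) with (inv_sqrt_coef 0 / (sqrt (x + h) * (x + h) ^ 0)); [exact Hs|].
  simpl. rewrite Rmult_1_r. unfold Rdiv; ring.
Qed.

(** * Convergence of improper integrals by domination *)

Lemma monotone_bounded_lim (F : R -> R) B :
  (forall x y, 0 <= x <= y -> F x <= F y) -> (forall x, 0 <= x -> F x <= B) ->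
  exists l, is_lim F p_infty (Finite l).
Proof.
  intros Hmon HB.
  destruct (completeness (fun y => exists x, 0 <= x /\ y = F x)) as [l [Hub Hlub]].
  - exists B. intros y [x [Hx ->]]. now apply HB.
  - exists (F 0), 0. split; [lra | reflexivity].
  - exists l. apply is_lim_spec. intros eps. simpl.
    pose proof (cond_pos eps) as He.
    destruct (excluded_middle_informative (exists x, 0 <= x /\ l - eps < F x)) as [[x0 [Hx0 Hl]]|Hno].
    + exists x0. intros x Hx.
      assert (F x0 <= F x) by (apply Hmon; lra).
      assert (F x <= l) by (apply Hub; exists x; split; [lra | reflexivity]).
      apply Rabs_def1; lra.
    + exfalso. assert (l <= l - eps); [|lra].
      apply Hlub. intros y [x [Hx ->]].
      destruct (Rle_lt_dec (F x) (l - eps)) as [|Hlt]; [assumption|].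
      exfalso; apply Hno; eauto.
Qed.

Lemma ex_RInt_cont (f : R -> R) a b : (forall t, continuous f t) -> ex_RInt f a b.
Proof. intros H. apply (@ex_RInt_continuous R_CompleteNormedModule). intros; apply H. Qed.

Lemma RInt_nonneg_lim (f : R -> R) B :
  (forall t, continuous f t) -> (forall t, 0 <= t -> 0 <= f t) ->
  (forall T, 0 <= T -> RInt f 0 T <= B) ->
  exists l, is_lim (fun T => RInt f 0 T) p_infty (Finite l).
Proof.
  intros Hc Hp HB. apply monotone_bounded_lim with B; [|exact HB].
  intros x y Hxy.
  rewrite <- (RInt_Chasles f 0 x y) by now apply ex_RInt_cont.
  assert (0 <= RInt f x y).
  { apply RInt_ge_0; [lra | now apply ex_RInt_cont | intros; apply Hp; lra]. }
  unfold plus; simpl; lra.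
Qed.

Lemma abs_RInt_dominated (f g : R -> R) T :
  (forall t, continuous f t) -> (forall t, continuous g t) ->
  (forall t, 0 <= t -> Rabs (f t) <= g t) -> 0 <= T ->
  Rabs (RInt f 0 T) <= RInt g 0 T.
Proof.
  intros Hf Hg Hfg HT.
  eapply Rle_trans; [apply abs_RInt_le; [exact HT | now apply ex_RInt_cont]|].
  apply RInt_le; try (now apply ex_RInt_cont); [exact HT| |intros; apply Hfg; lra].
  apply ex_RInt_cont. intros t. apply (continuous_comp f Rabs); [apply Hf | apply continuous_Rabs].
Qed.

Lemma is_lim_abs_le (F : R -> R) l B :
  is_lim F p_infty (Finite l) -> (forall T, 0 < T -> Rabs (F T) <= B) -> Rabs l <= B.
Proof.
  intros Hl HB.
  assert (Ha : is_lim (fun T => Rabs (F T)) p_infty (Finite (Rabs l))).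
  { apply (filterlim_comp _ _ _ F Rabs _ _ _ Hl). apply continuous_Rabs. }
  refine (is_lim_le_loc _ (fun _ => B) p_infty (Finite _) (Finite B) _ Ha (is_lim_const B p_infty)).
  exists 0. exact HB.
Qed.

(** Monotone convergence applies only to nonnegative integrands. Both [g] and [f + g] are
    nonnegative with bounded integrals, and the integral of [f] is the difference of theirs. *)
Lemma RInt_dominated_lim (f g : R -> R) B :
  (forall t, continuous f t) -> (forall t, continuous g t) ->
  (forall t, 0 <= t -> Rabs (f t) <= g t) ->
  (forall T, 0 <= T -> RInt g 0 T <= B) ->
  exists l, is_lim (fun T => RInt f 0 T) p_infty (Finite l) /\ Rabs l <= B.
Proof.
  intros Hf Hg Hfg HB.
  destruct (RInt_nonneg_lim g B Hg) as [lg Hlg].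
  { intros t Ht. pose proof (Hfg t Ht). pose proof (Rabs_pos (f t)). lra. }
  { exact HB. }
  assert (Hsum : forall T, RInt (fun t => f t + g t) 0 T = RInt f 0 T + RInt g 0 T).
  { intros T. apply (RInt_plus f g 0 T); now apply ex_RInt_cont. }
  destruct (RInt_nonneg_lim (fun t => f t + g t) (B + B)) as [ls Hls].
  - intros t. apply (continuous_plus f g); [apply Hf | apply Hg].
  - intros t Ht. pose proof (Hfg t Ht) as H. apply Rabs_le_between in H. lra.
  - intros T HT. rewrite Hsum. pose proof (abs_RInt_dominated f g T Hf Hg Hfg HT) as H.
    apply Rabs_le_between in H. specialize (HB T HT). lra.
  - assert (Hl : is_lim (fun T => RInt f 0 T) p_infty (Finite (ls - lg))).
    { eapply is_lim_ext; [|apply (is_lim_minus' _ _ _ _ _ Hls Hlg)].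
      intros T. simpl. rewrite Hsum. ring. }
    exists (ls - lg). split; [exact Hl|].
    apply (is_lim_abs_le _ _ _ Hl). intros T HT. eapply Rle_trans; [|apply (HB T); lra].
    apply abs_RInt_dominated; try assumption. lra.
Qed.

(** * The hyperbolic secant and its moments *)

Definition sech (t : R) : R := / cosh t.

Lemma cosh_pos t : 0 < cosh t.
Proof. unfold cosh. pose proof (exp_pos t). pose proof (exp_pos (- t)). lra. Qed.

Lemma sech_pos t : 0 < sech t.
Proof. apply Rinv_0_lt_compat, cosh_pos. Qed.

Lemma sech_bound t : sech t <= 2 * exp (- t).
Proof.
  unfold sech, cosh. rewrite exp_Ropp.
  pose proof (exp_pos t) as H. pose proof (Rinv_0_lt_compat _ H) as Hi.
  replace (2 * / exp t) with (/ (exp t / 2)) by (field; lra).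
  apply Rinv_le_contravar; lra.
Qed.

Lemma sech_even t : sech (- t) = sech t.
Proof. unfold sech, cosh. rewrite Ropp_involutive, (Rplus_comm (exp t)). reflexivity. Qed.

Lemma is_derive_sech t : is_derive sech t (- sech t * (sinh t / cosh t)).
Proof.
  unfold sech. pose proof (cosh_pos t).
  replace (- / cosh t * (sinh t / cosh t)) with (- sinh t / (cosh t) ^ 2) by (field; lra).
  apply is_derive_inv; [|lra]. apply is_derive_Reals, derivable_pt_lim_cosh.
Qed.

Lemma continuous_sech t : continuous sech t.
Proof. apply (ex_derive_continuous sech). eexists; apply is_derive_sech. Qed.

(** The factorial in the weight compensates the power exactly, so the bound does not depend on [n].
    This is the source of the uniform radius of [sech_hat]. *)
Lemma RInt_pow_exp_le n T :
  0 <= T -> RInt (fun t => t ^ n / INR (fact n) * (2 * exp (- t))) 0 T <= 2.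
Proof.
  intros HT.
  (* A primitive: differentiating exp (- t) times a truncated exponential series telescopes to its
     last term. It equals -2 at 0 and is never positive on t >= 0, whence the bound 2. *)
  set (E := fun N t => - 2 * exp (- t) * sum_f_R0 (fun k => t ^ k / INR (fact k)) N).
  assert (HE : forall N t, is_derive (E N) t (t ^ N / INR (fact N) * (2 * exp (- t)))).
  { induction N as [|N IH]; intros t.
    - unfold E; simpl. auto_derive; [exact I | field].
    - apply (is_derive_ext
        (fun t => E N t + - 2 * exp (- t) * (t ^ S N / INR (fact (S N))))).
      { intros s. unfold E. rewrite tech5.
        match goal with |- @eq _ ?a ?b => change (@eq R a b) end. ring. }
      replace (t ^ S N / INR (fact (S N)) * (2 * exp (- t))) with
        (t ^ N / INR (fact N) * (2 * exp (- t)) +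
         (2 * exp (- t) * (t ^ S N / INR (fact (S N)))
          + - 2 * exp (- t) * (t ^ N / INR (fact N)))) by ring.
      apply (is_derive_plus (E N)); [apply IH|].
      apply (is_derive_mult (fun t => - 2 * exp (- t)) (fun t => t ^ S N / INR (fact (S N)))).
      + auto_derive; [exact I | ring].
      + apply is_derive_pow_fact.
      + intros; apply Rmult_comm. }
  assert (HI : is_RInt (fun t => t ^ n / INR (fact n) * (2 * exp (- t))) 0 T
     (minus (E n T) (E n 0))).
  { apply (@is_RInt_derive R_CompleteNormedModule (E n)); intros; [apply HE|].
    apply (ex_derive_continuous (fun t => t ^ n / INR (fact n) * (2 * exp (- t)))).
    auto_derive. exact I. }
  rewrite (is_RInt_unique _ _ _ _ HI). unfold minus, plus, opp; simpl. unfold E.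
  assert (H0 : sum_f_R0 (fun k => 0 ^ k / INR (fact k)) n = 1).
  { destruct n as [|n]; [simpl; field|]. rewrite decomp_sum by lia.
    rewrite sum_eq_R0; [simpl; field|]. intros. rewrite pow_i by lia. unfold Rdiv; ring. }
  rewrite H0, Ropp_0, exp_0.
  assert (0 <= sum_f_R0 (fun k => T ^ k / INR (fact k)) n).
  { apply cond_pos_sum. intros k. apply Rmult_le_pos; [now apply pow_le|].
    left; apply Rinv_0_lt_compat, INR_fact_pos. }
  pose proof (exp_pos (- T)). nra.
Qed.

(** The coefficient of h^k in the expansion of [sech t * cos ((nu + h) * t)]: each derivative in
    [nu] brings down a factor [t] and advances the phase by [PI / 2]. *)
Definition sech_moment (nu : R) (k : nat) (t : R) : R :=
  sech t * (cos (nu * t + INR k * (PI / 2)) * (t ^ k / INR (fact k))).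

Lemma continuous_sech_moment nu k t : continuous (sech_moment nu k) t.
Proof.
  apply (continuous_mult sech); [apply continuous_sech|].
  apply (ex_derive_continuous (fun t => cos (nu * t + INR k * (PI / 2)) * (t ^ k / INR (fact k)))).
  auto_derive. exact I.
Qed.

Lemma continuous_pow_exp n t : continuous (fun t => t ^ n / INR (fact n) * (2 * exp (- t))) t.
Proof.
  apply (ex_derive_continuous (fun t => t ^ n / INR (fact n) * (2 * exp (- t)))).
  auto_derive. exact I.
Qed.

Lemma pow_fact_nonneg t n : 0 <= t -> 0 <= t ^ n / INR (fact n).
Proof.
  intros Ht. apply Rmult_le_pos; [now apply pow_le|].
  left; apply Rinv_0_lt_compat, INR_fact_pos.
Qed.

Lemma sech_times_le t n a :
  0 <= t -> Rabs a <= t ^ n / INR (fact n) ->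
  Rabs (sech t * a) <= t ^ n / INR (fact n) * (2 * exp (- t)).
Proof.
  intros Ht Ha. pose proof (sech_pos t). pose proof (sech_bound t).
  rewrite Rabs_mult, (Rabs_pos_eq (sech t)), Rmult_comm by lra.
  apply Rmult_le_compat; try apply Rabs_pos; lra.
Qed.

Lemma sech_moment_le nu k t :
  0 <= t -> Rabs (sech_moment nu k t) <= t ^ k / INR (fact k) * (2 * exp (- t)).
Proof.
  intros Ht. apply sech_times_le; [exact Ht|].
  pose proof (pow_fact_nonneg t k Ht).
  rewrite Rabs_mult, (Rabs_pos_eq (t ^ k / _)) by assumption.
  pose proof (COS_bound (nu * t + INR k * (PI / 2))) as Hc.
  assert (Rabs (cos (nu * t + INR k * (PI / 2))) <= 1) by (apply Rabs_le; lra). nra.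
Qed.

Lemma sech_moment_lim nu k : exists l,
  is_lim (fun T => RInt (sech_moment nu k) 0 T) p_infty (Finite l) /\ Rabs l <= 2.
Proof.
  apply RInt_dominated_lim with (fun t => t ^ k / INR (fact k) * (2 * exp (- t))).
  - apply continuous_sech_moment.
  - apply continuous_pow_exp.
  - apply sech_moment_le.
  - apply RInt_pow_exp_le.
Qed.

Definition sech_coef (nu : R) (k : nat) : R :=
  real (Lim (fun T => RInt (sech_moment nu k) 0 T) p_infty).

Lemma sech_coef_lim nu k :
  is_lim (fun T => RInt (sech_moment nu k) 0 T) p_infty (Finite (sech_coef nu k)).
Proof.
  destruct (sech_moment_lim nu k) as [l [Hl _]].
  unfold sech_coef. rewrite (is_lim_unique _ _ _ Hl). exact Hl.
Qed.

Lemma sech_coef_bound nu k : Rabs (sech_coef nu k) <= 2.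
Proof.
  destruct (sech_moment_lim nu k) as [l [Hl HB]].
  unfold sech_coef. rewrite (is_lim_unique _ _ _ Hl). exact HB.
Qed.

(* Half of the Fourier transform of [sech], i.e. the integral over [0, +oo). *)
Definition sech_hat (nu : R) : R := sech_coef nu 0.

Lemma cos_taylor_bound a x N :
  Rabs (cos (a + x) - sum_f_R0 (fun k => cos (a + INR k * (PI / 2)) / INR (fact k) * x ^ k) N)
  <= Rabs x ^ S N / INR (fact (S N)).
Proof.
  rewrite <- (Rmult_1_l (Rabs x ^ S N / _)).
  replace (cos (a + x)) with (cos (a + x + INR 0 * (PI / 2))) by (f_equal; simpl; ring).
  apply (taylor_bound (fun n y => cos (y + INR n * (PI / 2)))).
  - intros n y _. auto_derive; [exact I|].
    rewrite S_INR. replace (y + (INR n + 1) * (PI / 2)) with (PI / 2 + (y + INR n * (PI / 2))) by ring.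
    rewrite sin_cos. ring.
  - intros y _. pose proof (COS_bound (y + INR (S N) * (PI / 2))). apply Rabs_le; lra.
Qed.

Lemma is_RInt_sum (f : nat -> R -> R) (l : nat -> R) a b N :
  (forall k, is_RInt (f k) a b (l k)) ->
  is_RInt (fun t => sum_f_R0 (fun k => f k t) N) a b (sum_f_R0 l N).
Proof.
  intros H. induction N as [|N IH]; simpl; [apply H|].
  apply (is_RInt_plus (fun t => sum_f_R0 (fun k => f k t) N)); [exact IH | apply H].
Qed.

Lemma continuous_sum (f : nat -> R -> R) N t :
  (forall k, continuous (f k) t) -> continuous (fun t => sum_f_R0 (fun k => f k t) N) t.
Proof.
  intros H. induction N as [|N IH]; simpl; [apply H|].
  apply (continuous_plus (fun t => sum_f_R0 (fun k => f k t) N)); [exact IH | apply H].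
Qed.

Lemma is_lim_sum (f : nat -> R -> R) (l : nat -> R) x N :
  (forall k, is_lim (f k) x (Finite (l k))) ->
  is_lim (fun t => sum_f_R0 (fun k => f k t) N) x (Finite (sum_f_R0 l N)).
Proof.
  intros H. induction N as [|N IH]; simpl; [apply H|].
  apply (is_lim_plus' (fun t => sum_f_R0 (fun k => f k t) N)); [exact IH | apply H].
Qed.

(** Taylor's formula for the cosine under the integral sign: all its derivatives are bounded by 1,
    so the remainder at time [t] is at most |h t|^(N+1) / (N+1)!, and integrating it against 2 exp
    (- t) costs only the factor 2. *)
Lemma sech_hat_remainder nu h N :
  Rabs (sech_hat (nu + h) - sum_f_R0 (fun k => sech_coef nu k * h ^ k) N)
    <= 2 * Rabs h ^ S N.
Proof.
  set (d := fun t => sech_moment (nu + h) 0 t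
              - sum_f_R0 (fun k => h ^ k * sech_moment nu k t) N).
  assert (Hdc : forall t, continuous d t).
  { intros t. apply (continuous_minus (sech_moment (nu + h) 0)); [apply continuous_sech_moment|].
    apply (continuous_sum (fun k t => h ^ k * sech_moment nu k t)). intros k.
    apply (continuous_scal_r (h ^ k) (sech_moment nu k)), continuous_sech_moment. }
  assert (Hd : forall t, 0 <= t ->
    Rabs (d t) <= Rabs h ^ S N * (t ^ S N / INR (fact (S N)) * (2 * exp (- t)))).
  { intros t Ht.
    replace (d t) with (sech t * (cos (nu * t + h * t) -
      sum_f_R0 (fun k => cos (nu * t + INR k * (PI / 2)) / INR (fact k) * (h * t) ^ k) N)).
    - pose proof (cos_taylor_bound (nu * t) (h * t) N) as Hb.
      rewrite Rabs_mult, (Rabs_pos_eq (sech t)) by (left; apply sech_pos).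
      rewrite Rabs_mult, (Rabs_pos_eq t), Rpow_mult_distr in Hb by exact Ht.
      replace (Rabs h ^ S N * (t ^ S N / INR (fact (S N)) * (2 * exp (- t)))) with
        (2 * exp (- t) * (Rabs h ^ S N * t ^ S N / INR (fact (S N)))) by (unfold Rdiv; ring).
      apply Rmult_le_compat; try apply Rabs_pos; [left; apply sech_pos | apply sech_bound | exact Hb].
    - unfold d, sech_moment. rewrite Rmult_minus_distr_l. f_equal.
      + simpl. replace ((nu + h) * t + 0 * (PI / 2)) with (nu * t + h * t) by ring. field.
      + rewrite scal_sum. apply sum_eq. intros k _. rewrite Rpow_mult_distr. unfold Rdiv; ring. }
  assert (HRd : forall T, RInt d 0 T = RInt (sech_moment (nu + h) 0) 0 T
     - sum_f_R0 (fun k => h ^ k * RInt (sech_moment nu k) 0 T) N).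
  { intros T. apply is_RInt_unique.
    apply (is_RInt_minus (sech_moment (nu + h) 0)
      (fun t => sum_f_R0 (fun k => h ^ k * sech_moment nu k t) N)).
    - apply (@RInt_correct R_CompleteNormedModule), ex_RInt_cont, continuous_sech_moment.
    - apply (is_RInt_sum (fun k t => h ^ k * sech_moment nu k t)). intros k.
      apply (is_RInt_scal (sech_moment nu k)).
      apply (@RInt_correct R_CompleteNormedModule), ex_RInt_cont, continuous_sech_moment. }
  assert (Hlim : is_lim (fun T => RInt d 0 T) p_infty
    (Finite (sech_hat (nu + h) - sum_f_R0 (fun k => sech_coef nu k * h ^ k) N))).
  { apply is_lim_ext with (fun T => RInt (sech_moment (nu + h) 0) 0 T
     - sum_f_R0 (fun k => h ^ k * RInt (sech_moment nu k) 0 T) N).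
    { intros; now rewrite HRd. }
    apply is_lim_minus'; [apply sech_coef_lim|].
    apply (is_lim_sum (fun k T => h ^ k * RInt (sech_moment nu k) 0 T)). intros k.
    rewrite Rmult_comm.
    apply (is_lim_scal_l _ (h ^ k) p_infty (Finite (sech_coef nu k))), sech_coef_lim. }
  apply (is_lim_abs_le _ _ _ Hlim). intros T HT.
  eapply Rle_trans.
  - apply (abs_RInt_dominated d
      (fun t => Rabs h ^ S N * (t ^ S N / INR (fact (S N)) * (2 * exp (- t))))); try assumption; [|lra].
    intros t. apply (continuous_scal_r (Rabs h ^ S N)
      (fun t => t ^ S N / INR (fact (S N)) * (2 * exp (- t)))), continuous_pow_exp.
  - rewrite (RInt_scal (fun t => t ^ S N / INR (fact (S N)) * (2 * exp (- t))))
      by (apply ex_RInt_cont, continuous_pow_exp).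
    unfold scal; simpl; unfold mult; simpl. rewrite Rmult_comm.
    apply Rmult_le_compat_r; [|apply (RInt_pow_exp_le (S N)); lra].
    apply (pow_le (Rabs h) (S N)), Rabs_pos.
Qed.

(* The coefficients are bounded uniformly in [nu], so the radius is at least 1
   everywhere. *)
Lemma sech_hat_series nu h :
  Rabs h < 1 -> is_series (fun k => sech_coef nu k * h ^ k) (sech_hat (nu + h)).
Proof.
  intros Hh. apply is_series_of_geom_remainder with 2 (Rabs h).
  - now rewrite Rabs_Rabsolu.
  - intros N. apply sech_hat_remainder.
Qed.

Lemma analytic1_sech_hat nu : analytic1 sech_hat nu.
Proof.
  exists (sech_coef nu), 2, 1. split; [lra|]. split.
  - intros k. rewrite pow1, Rmult_1_r. apply sech_coef_bound.
  - intros h Hh. apply sech_hat_series. lra.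
Qed.

Lemma sech_hat_0_pos : 0 < sech_hat 0.
Proof.
  set (f := sech_moment 0 0).
  assert (Hf : forall t, f t = sech t).
  { intros t. unfold f, sech_moment. rewrite Rmult_0_l. simpl.
    rewrite Rmult_0_l, Rplus_0_r, cos_0. field. }
  assert (H1 : 0 < RInt f 0 1).
  { apply RInt_gt_0; [lra | intros; rewrite Hf; apply sech_pos|].
    intros; apply continuous_sech_moment. }
  apply Rlt_le_trans with (1 := H1).
  refine (is_lim_le_loc (fun _ => RInt f 0 1) (fun T => RInt f 0 T) p_infty
    (Finite (RInt f 0 1)) (Finite (sech_hat 0)) _ (is_lim_const _ p_infty) (sech_coef_lim 0 0)).
  exists 1. intros T HT.
  rewrite <- (RInt_Chasles f 0 1 T) by apply ex_RInt_cont, continuous_sech_moment.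
  assert (0 <= RInt f 1 T).
  { apply RInt_ge_0; [lra | apply ex_RInt_cont, continuous_sech_moment|].
    intros; rewrite Hf; left; apply sech_pos. }
  unfold plus; simpl; lra.
Qed.

(** * Zeros of [sech_hat] *)

(** Vanishing near [nu] kills every coefficient of the power series there, and this same series
    represents [sech_hat] up to distance 1. *)
Lemma sech_hat_zero_spreads nu delta :
  0 < delta -> (forall y, Rabs (y - nu) < delta -> sech_hat y = 0) ->
  forall y, Rabs (y - nu) < 1 -> sech_hat y = 0.
Proof.
  intros Hd Hz.
  assert (Hps : forall h, Rabs h < 1 -> PSeries (sech_coef nu) h = sech_hat (nu + h)).
  { intros h Hh. apply is_series_unique, sech_hat_series, Hh. }
  assert (Hc : forall k, sech_coef nu k = 0).
  { intros k. apply (PSeries_ext_recip (sech_coef nu) (fun _ => 0)).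
    - apply Rbar_lt_le_trans with (Finite 1); [simpl; lra|].
      apply (proj1 (CV_radius_bounded (sech_coef nu))). exists 2. intros n.
      rewrite pow1, Rmult_1_r. apply sech_coef_bound.
    - rewrite CV_radius_const_0. exact I.
    - assert (Hm : 0 < Rmin delta 1) by (apply Rmin_glb_lt; lra).
      exists (mkposreal _ Hm). intros h Hh.
      change (Rabs (h - 0) < Rmin delta 1) in Hh. rewrite Rminus_0_r in Hh.
      pose proof (Rmin_l delta 1). pose proof (Rmin_r delta 1).
      rewrite PSeries_const_0, Hps by lra. apply Hz.
      rewrite Rplus_minus_l. lra. }
  intros y Hy. replace y with (nu + (y - nu)) by ring. rewrite <- Hps by exact Hy.
  rewrite (PSeries_ext _ (fun _ => 0)) by exact Hc. apply PSeries_const_0.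
Qed.

Lemma sech_hat_not_locally_zero nu delta :
  0 < delta -> ~ (forall y, Rabs (y - nu) < delta -> sech_hat y = 0).
Proof.
  intros Hd Hz.
  assert (Hall : forall n y, Rabs (y - nu) < 1 + INR n / 2 -> sech_hat y = 0).
  { induction n as [|n IH]; intros y Hy.
    - apply (sech_hat_zero_spreads nu delta Hd Hz). simpl in Hy. lra.
    - rewrite S_INR in Hy.
      destruct (Rlt_le_dec (Rabs (y - nu)) (1 + INR n / 2)) as [H|H]; [now apply IH|].
      pose proof (pos_INR n) as Hn.
      (* The centre [z] lies 3/4 closer to [nu] than [y]. Its disc of radius 1/4 stays in the zone
         already settled, as 3/4 + n/2 + 1/4 = 1 + n/2, and [y] is at distance 3/4 < 1, so each
         round gains one half. *)
      set (z := if Rle_dec nu y then y - 3 / 4 else y + 3 / 4).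
      assert (Hz1 : Rabs (z - nu) < 3 / 4 + INR n / 2 /\ Rabs (y - z) < 1).
      { unfold z. destruct (Rle_dec nu y) as [Hle|Hgt].
        - rewrite Rabs_pos_eq in Hy, H by lra. split; apply Rabs_def1; lra.
        - rewrite Rabs_left in Hy, H by lra. split; apply Rabs_def1; lra. }
      apply (sech_hat_zero_spreads z (1 / 4)); [lra | | apply Hz1].
      intros x Hx. apply IH.
      replace (x - nu) with ((x - z) + (z - nu)) by ring.
      pose proof (Rabs_triang (x - z) (z - nu)). lra. }
  destruct (INR_unbounded (2 * Rabs nu)) as [n Hn].
  pose proof sech_hat_0_pos as H0. rewrite (Hall n 0) in H0; [lra|].
  rewrite Rminus_0_l, Rabs_Ropp. lra.
Qed.

(** * Parity and limits of the two primitives *)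

Definition sech_cos_int (nu x : R) : R := RInt (sech_moment nu 0) 0 x.
Definition sech_sin_int (nu x : R) : R := RInt (fun t => sech t * sin (nu * t)) 0 x.

Lemma continuous_sech_sin nu t : continuous (fun t => sech t * sin (nu * t)) t.
Proof.
  apply (continuous_mult sech); [apply continuous_sech|].
  apply (ex_derive_continuous (fun t => sin (nu * t))). auto_derive. exact I.
Qed.

Lemma is_derive_RInt_cont (f : R -> R) x :
  (forall t, continuous f t) -> is_derive (fun x => RInt f 0 x) x (f x).
Proof.
  intros Hf. apply is_derive_RInt with 0; [|apply Hf].
  exists (mkposreal 1 Rlt_0_1). intros y _.
  apply (@RInt_correct R_CompleteNormedModule), ex_RInt_cont, Hf.
Qed.

Lemma sech_moment_0 nu t : sech_moment nu 0 t = sech t * cos (nu * t).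
Proof.
  unfold sech_moment. simpl. rewrite Rmult_0_l, Rplus_0_r. field.
Qed.

Lemma is_derive_sech_cos_int nu x :
  is_derive (sech_cos_int nu) x (sech x * cos (nu * x)).
Proof.
  rewrite <- sech_moment_0. apply is_derive_RInt_cont, continuous_sech_moment.
Qed.

Lemma is_derive_sech_sin_int nu x :
  is_derive (sech_sin_int nu) x (sech x * sin (nu * x)).
Proof.
  apply (is_derive_RInt_cont (fun t => sech t * sin (nu * t))), continuous_sech_sin.
Qed.

Lemma RInt_0_opp (f : R -> R) x :
  (forall t, continuous f t) -> RInt f 0 (- x) = - RInt (fun t => f (- t)) 0 x.
Proof.
  intros Hf. apply is_RInt_unique.
  rewrite <- (Ropp_0) at 1.
  assert (H := is_RInt_comp_opp (fun t => f (- t)) (- 0) (- x)).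
  rewrite !Ropp_involutive in H.
  assert (Hc : forall t, continuous (fun t => f (- t)) t).
  { intros t. apply (continuous_comp (fun t => - t) f); [|apply Hf].
    apply (ex_derive_continuous (fun t => - t)). auto_derive. exact I. }
  specialize (H (RInt (fun t => f (- t)) 0 x)
    (@RInt_correct R_CompleteNormedModule _ _ _ (ex_RInt_cont _ _ _ Hc))).
  apply is_RInt_opp in H.
  eapply is_RInt_ext; [|exact H]. intros t _. unfold opp; simpl. rewrite !Ropp_involutive. reflexivity.
Qed.

Lemma sech_cos_int_odd nu x : sech_cos_int nu (- x) = - sech_cos_int nu x.
Proof.
  unfold sech_cos_int. rewrite RInt_0_opp by apply continuous_sech_moment.
  f_equal. apply RInt_ext. intros t _. rewrite !sech_moment_0, sech_even.
  rewrite <- Ropp_mult_distr_r, cos_neg. reflexivity.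
Qed.

Lemma sech_sin_int_even nu x : sech_sin_int nu (- x) = sech_sin_int nu x.
Proof.
  unfold sech_sin_int. rewrite RInt_0_opp by apply continuous_sech_sin.
  rewrite <- (RInt_opp (fun t => sech (- t) * sin (nu * - t))).
  - apply RInt_ext. intros t _. unfold opp; simpl.
    rewrite sech_even, <- Ropp_mult_distr_r, sin_neg. ring.
  - apply ex_RInt_ext with (fun t => - (sech t * sin (nu * t))).
    + intros t _. rewrite sech_even, <- Ropp_mult_distr_r, sin_neg.
    match goal with |- @eq _ ?a ?b => change (@eq R a b) end. ring.
    + apply ex_RInt_cont. intros t.
      apply (continuous_opp (fun t => sech t * sin (nu * t))), continuous_sech_sin.
Qed.

Lemma sech_cos_int_lim nu : is_lim (sech_cos_int nu) p_infty (Finite (sech_hat nu)).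
Proof. apply sech_coef_lim. Qed.

(** Existence of the limit suffices: the primitive is even, so its limits at the two ends of the
    line coincide and cancel. *)
Lemma sech_sin_int_lim nu : exists l, is_lim (sech_sin_int nu) p_infty (Finite l).
Proof.
  destruct (RInt_dominated_lim (fun t => sech t * sin (nu * t))
    (fun t => t ^ 0 / INR (fact 0) * (2 * exp (- t))) 2) as [l [Hl _]].
  - apply continuous_sech_sin.
  - apply continuous_pow_exp.
  - intros t Ht. apply sech_times_le; [exact Ht|]. simpl.
    pose proof (SIN_bound (nu * t)). apply Rabs_le; lra.
  - apply RInt_pow_exp_le.
  - now exists l.
Qed.

Lemma is_lim_opp_infty (f : R -> R) l :
  is_lim (fun x => f (- x)) p_infty l -> is_lim f m_infty l.
Proof.
  intros H. apply is_lim_ext with (fun x => f (- - x)).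
  { intros x; f_equal; ring. }
  apply (is_lim_comp (fun x => f (- x)) Ropp m_infty l p_infty H).
  - apply (is_lim_opp (fun x => x) m_infty m_infty). apply is_lim_id.
  - exists 0. intros; discriminate.
Qed.

(** * The Melnikov kernel *)

Lemma is_RInt_gen_primitive (F f : R -> R) lm lp :
  (forall x, is_derive F x (f x)) -> (forall x, continuous f x) ->
  is_lim F m_infty (Finite lm) -> is_lim F p_infty (Finite lp) ->
  is_RInt_gen f (Rbar_locally m_infty) (Rbar_locally p_infty) (lp - lm).
Proof.
  intros HF Hf Hm Hp.
  replace f with (Derive F) in *
    by (apply functional_extensionality; intros; apply is_derive_unique, HF).
  assert (Htriv : forall Q : R -> Prop, (forall x, Q x) ->
    filter_prod (Rbar_locally m_infty) (Rbar_locally p_infty) (fun ab : R * R =>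
      forall x, Rmin (fst ab) (snd ab) <= x <= Rmax (fst ab) (snd ab) -> Q x)).
  { intros Q HQ. apply filter_forall. intros; apply HQ. }
  apply (is_RInt_gen_Derive F lm lp); try assumption; apply Htriv.
  - intros x; eexists; apply HF.
  - exact Hf.
Qed.

Lemma is_lim_scale_p (f : R -> R) k l :
  0 < k -> is_lim f p_infty l -> is_lim (fun t => f (k * t)) p_infty l.
Proof.
  intros Hk H P HP. destruct (H P HP) as [M HM]. exists (M / k). intros x Hx.
  apply HM. apply Rmult_lt_reg_r with (/ k); [now apply Rinv_0_lt_compat|].
  replace (k * x * / k) with x by (field; lra). exact Hx.
Qed.

Lemma is_lim_scale_m (f : R -> R) k l :
  0 < k -> is_lim f m_infty l -> is_lim (fun t => f (k * t)) m_infty l.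
Proof.
  intros Hk H P HP. destruct (H P HP) as [M HM]. exists (M / k). intros x Hx.
  apply HM. apply Rmult_lt_reg_r with (/ k); [now apply Rinv_0_lt_compat|].
  replace (k * x * / k) with x by (field; lra). exact Hx.
Qed.

Definition tgh (t : R) : R := sinh t / cosh t.

Lemma sech_tgh t : sech t ^ 2 = 1 - tgh t ^ 2.
Proof.
  unfold sech, tgh. pose proof (cosh_pos t) as H.
  assert (Hc : cosh t ^ 2 - sinh t ^ 2 = 1).
  { unfold cosh, sinh. rewrite exp_Ropp. pose proof (exp_pos t). field. lra. }
  replace (1 - (sinh t / cosh t) ^ 2) with ((cosh t ^ 2 - sinh t ^ 2) / cosh t ^ 2)
    by (field; lra).
  rewrite Hc. field; lra.
Qed.

Lemma is_derive_tgh t : is_derive tgh t (1 - tgh t ^ 2).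
Proof.
  unfold tgh. pose proof (cosh_pos t).
  replace (1 - (sinh t / cosh t) ^ 2) with
    ((cosh t * cosh t - sinh t * sinh t) / cosh t ^ 2) by (field; lra).
  apply (is_derive_div sinh cosh); [| |lra].
  - apply is_derive_Reals, derivable_pt_lim_sinh.
  - apply is_derive_Reals, derivable_pt_lim_cosh.
Qed.

Lemma is_derive_sech_scale k t :
  is_derive (fun t => sech (k * t)) t (- k * sech (k * t) * tgh (k * t)).
Proof.
  replace (- k * sech (k * t) * tgh (k * t)) with
    (k * (- sech (k * t) * (sinh (k * t) / cosh (k * t)))) by (unfold tgh; ring).
  apply (is_derive_comp sech (fun t => k * t)); [apply is_derive_sech|].
  auto_derive; [exact I | ring].
Qed.

Lemma is_derive_tgh_scale k t :
  is_derive (fun t => tgh (k * t)) t (k * (1 - tgh (k * t) ^ 2)).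
Proof.
  apply (is_derive_comp tgh (fun t => k * t)); [apply is_derive_tgh|].
  auto_derive; [exact I | ring].
Qed.

Lemma tgh_bound t : Rabs (tgh t) <= 1.
Proof.
  apply Rabs_le. pose proof (sech_tgh t). pose proof (sech_pos t).
  assert (0 < sech t ^ 2) by (apply pow_lt; assumption). nra.
Qed.

Lemma sech_lim_p : is_lim sech p_infty (Finite 0).
Proof.
  apply (is_lim_le_le_loc (fun _ => 0) (fun t => 2 * exp (- t))).
  - exists 0. intros t _. split; [left; apply sech_pos | apply sech_bound].
  - apply is_lim_const.
  - replace (Finite 0) with (Rbar_mult 2 0) by (simpl; f_equal; ring).
    apply is_lim_scal_l.
    apply (is_lim_comp exp Ropp p_infty 0 m_infty); [apply is_lim_exp_m | |].
    + apply (is_lim_opp (fun x => x) p_infty p_infty), is_lim_id.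
    + exists 0. intros; discriminate.
Qed.

Lemma sech_lim_m : is_lim sech m_infty (Finite 0).
Proof.
  apply is_lim_opp_infty. eapply is_lim_ext; [|apply sech_lim_p].
  intros; symmetry; apply sech_even.
Qed.

Lemma is_lim_null_bounded (f g : R -> R) C x :
  is_lim f x (Finite 0) -> (forall t, Rabs (g t) <= C) ->
  is_lim (fun t => f t * g t) x (Finite 0).
Proof.
  intros Hf Hg.
  assert (HC : 0 <= C) by (pose proof (Hg 0); pose proof (Rabs_pos (g 0)); lra).
  apply is_lim_spec. intros eps. simpl. apply is_lim_spec in Hf.
  assert (He : 0 < eps / (C + 1)) by (apply Rdiv_lt_0_compat; [apply cond_pos | lra]).
  specialize (Hf (mkposreal _ He)). simpl in Hf.
  eapply filter_imp; [|exact Hf]. intros t Ht. simpl in Ht.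
  rewrite Rminus_0_r in *. rewrite Rabs_mult.
  apply Rle_lt_trans with (Rabs (f t) * (C + 1)).
  - apply Rmult_le_compat_l; [apply Rabs_pos | pose proof (Hg t); lra].
  - apply Rmult_lt_reg_r with (/ (C + 1)); [apply Rinv_0_lt_compat; lra|].
    replace (Rabs (f t) * (C + 1) * / (C + 1)) with (Rabs (f t)) by (field; lra). exact Ht.
Qed.

(* Integrating by parts twice reduces both kernels to [sech * sin]: up to exact
   derivatives, [sech tanh cos = nu sech sin] and
   [sech tanh^2 sin = (1 - nu^2)/2 sech sin]. *)
Lemma is_RInt_gen_melnikov_kernel a b c k nu g0 :
  0 < k ->
  is_RInt_gen
    (fun t => sech (k * t) * ((a - b * tgh (k * t) ^ 2) * sin (g0 - nu * (k * t))
                              + c * tgh (k * t) * cos (g0 - nu * (k * t))))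
    (Rbar_locally m_infty) (Rbar_locally p_infty)
    ((a - b * (1 - nu ^ 2) / 2 + c * nu) / k * (2 * sech_hat nu) * sin g0).
Proof.
  intros Hk.
  set (E := a - b * (1 - nu ^ 2) / 2 + c * nu).
  (* [sech * D] gathers the exact derivatives left by the integrations by parts: in x = k t, the
     derivative of sech cos is - sech tanh cos + nu sech sin, that of sech tanh sin is sech sin - 2
     sech tanh^2 sin - nu sech tanh cos. As [D] is bounded, these terms die at both ends. *)
  set (D := fun t => - (c + b * nu / 2) * cos (g0 - nu * (k * t))
                     + b / 2 * (tgh (k * t) * sin (g0 - nu * (k * t)))).
  set (F := fun t => (E * (sin g0 * sech_cos_int nu (k * t) - cos g0 * sech_sin_int nu (k * t))
                     + sech (k * t) * D t) / k).
  destruct (sech_sin_int_lim nu) as [ls Hls].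
  assert (HD : forall t, Rabs (D t) <= Rabs (c + b * nu / 2) + Rabs (b / 2)).
  { intros t. unfold D. eapply Rle_trans; [apply Rabs_triang|].
    rewrite !Rabs_mult, Rabs_Ropp.
    assert (Hc : Rabs (cos (g0 - nu * (k * t))) <= 1)
      by (apply Rabs_le; pose proof (COS_bound (g0 - nu * (k * t))); lra).
    assert (Hs : Rabs (sin (g0 - nu * (k * t))) <= 1)
      by (apply Rabs_le; pose proof (SIN_bound (g0 - nu * (k * t))); lra).
    pose proof (tgh_bound (k * t)) as Ht.
    pose proof (Rabs_pos (cos (g0 - nu * (k * t)))).
    pose proof (Rabs_pos (sin (g0 - nu * (k * t)))).
    pose proof (Rabs_pos (tgh (k * t))).
    pose proof (Rabs_pos (c + b * nu / 2)). pose proof (Rabs_pos (b / 2)).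
    assert (Rabs (tgh (k * t)) * Rabs (sin (g0 - nu * (k * t))) <= 1) by nra.
    apply Rplus_le_compat; rewrite <- Rmult_1_r; apply Rmult_le_compat_l; assumption. }
  assert (Hlim : forall x lc, is_lim (fun t => sech (k * t)) x (Finite 0) ->
    is_lim (fun t => sech_cos_int nu (k * t)) x (Finite lc) ->
    is_lim (fun t => sech_sin_int nu (k * t)) x (Finite ls) ->
    is_lim F x (Finite ((E * (sin g0 * lc - cos g0 * ls) + 0) / k))).
  { intros x lc H1 H2 H3. unfold F.
    assert (Hs1 := is_lim_scal_l _ (sin g0) _ _ H2).
    assert (Hs2 := is_lim_scal_l _ (cos g0) _ _ H3).
    assert (Hm := is_lim_minus' _ _ _ _ _ Hs1 Hs2).
    assert (He := is_lim_scal_l _ E _ _ Hm).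
    assert (Hd := is_lim_null_bounded _ _ _ _ H1 HD).
    exact (is_lim_scal_r _ (/ k) _ _ (is_lim_plus' _ _ _ _ _ He Hd)). }
  (* The odd cosine primitive counts twice and the even sine primitive cancels, so [cos g0]
     disappears from the result. *)
  replace (E / k * (2 * sech_hat nu) * sin g0) with
    ((E * (sin g0 * sech_hat nu - cos g0 * ls) + 0) / k
     - (E * (sin g0 * (- sech_hat nu) - cos g0 * ls) + 0) / k) by (field; lra).
  apply is_RInt_gen_primitive with F.
  - intros t.
    set (S := fun t => sech (k * t)). set (T := fun t => tgh (k * t)).
    set (Jc := fun t => sech_cos_int nu (k * t)).
    set (Js := fun t => sech_sin_int nu (k * t)).
    assert (HS : is_derive S t (- k * S t * T t)) by apply is_derive_sech_scale.
    assert (HT : is_derive T t (k * (1 - T t ^ 2))) by apply is_derive_tgh_scale.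
    assert (HJc : is_derive Jc t
       (k * (sech (k * t) * cos (nu * (k * t))))).
    { apply (is_derive_comp (sech_cos_int nu) (fun t => k * t));
        [apply is_derive_sech_cos_int|]. auto_derive; [exact I | ring]. }
    assert (HJs : is_derive Js t
       (k * (sech (k * t) * sin (nu * (k * t))))).
    { apply (is_derive_comp (sech_sin_int nu) (fun t => k * t));
        [apply is_derive_sech_sin_int|]. auto_derive; [exact I | ring]. }
    unfold F, D.
    apply (is_derive_ext (fun t => (E * (sin g0 * Jc t - cos g0 * Js t)
      + S t * (- (c + b * nu / 2) * cos (g0 - nu * (k * t))
                     + b / 2 * (T t * sin (g0 - nu * (k * t))))) / k)); [reflexivity|].
    change (sech (k * t)) with (S t) in *. change (tgh (k * t)) with (T t) in *.
    clearbody S T Jc Js.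
    auto_derive.
    + repeat split; eexists; eassumption.
    + assert (DS : Derive (fun x : R => S x) t = - k * S t * T t)
        by (apply is_derive_unique; exact HS).
      assert (DT : Derive (fun x : R => T x) t = k * (1 - T t ^ 2))
        by (apply is_derive_unique; exact HT).
      assert (DJc : Derive (fun x : R => Jc x) t = k * (S t * cos (nu * (k * t))))
        by (apply is_derive_unique; exact HJc).
      assert (DJs : Derive (fun x : R => Js x) t = k * (S t * sin (nu * (k * t))))
        by (apply is_derive_unique; exact HJs).
      rewrite DS, DT, DJc, DJs.
      unfold E. replace (g0 + - (nu * (k * t))) with (g0 - nu * (k * t)) by ring.
      rewrite sin_minus, cos_minus.
      field. lra.
  - intros t.
    apply (continuous_mult (fun t => sech (k * t))).
    + apply (ex_derive_continuous (fun t => sech (k * t))). eexists; apply is_derive_sech_scale.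
    + set (T := fun t => tgh (k * t)).
      assert (HT : is_derive T t (k * (1 - T t ^ 2))) by apply is_derive_tgh_scale.
      apply (ex_derive_continuous (fun t => (a - b * tgh (k * t) ^ 2) * sin (g0 - nu * (k * t))
                              + c * tgh (k * t) * cos (g0 - nu * (k * t)))).
      apply (ex_derive_ext (fun t => (a - b * T t ^ 2) * sin (g0 - nu * (k * t))
                              + c * T t * cos (g0 - nu * (k * t)))); [reflexivity|].
      clearbody T. auto_derive. repeat split; eexists; eassumption.
  - apply Hlim.
    + apply is_lim_scale_m; [exact Hk | apply sech_lim_m].
    + apply is_lim_scale_m; [exact Hk|]. apply is_lim_opp_infty.
      eapply is_lim_ext; [intros; symmetry; apply sech_cos_int_odd|].
      apply (is_lim_opp _ _ (Finite (sech_hat nu))), sech_cos_int_lim.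
    + apply is_lim_scale_m; [exact Hk|]. apply is_lim_opp_infty.
      eapply is_lim_ext; [intros; symmetry; apply sech_sin_int_even|]. exact Hls.
  - apply Hlim; apply is_lim_scale_p; try exact Hk.
    + apply sech_lim_p.
    + apply sech_cos_int_lim.
    + exact Hls.
Qed.

(** * The separatrix *)

(** The squared form of the domain is the one that arithmetic uses: it says that
    [2 * sep_W L Gam ^ 2] is positive. *)
Lemma dom_O_bounds L Gam : dom_O (L, Gam) <-> 0 < L /\ 0 < Gam /\ 5 * Gam ^ 2 < 3 * L ^ 2.
Proof.
  unfold dom_O; simpl fst; simpl snd.
  assert (Hs : 0 < sqrt (3 / 5)) by (apply sqrt_lt_R0; lra).
  assert (Hss : sqrt (3 / 5) ^ 2 = 3 / 5) by (apply pow2_sqrt; lra).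
  split; intros H; destruct H as [HL [HG H]]; (split; [exact HL|]); (split; [exact HG|]).
  - assert (Gam ^ 2 < (L * sqrt (3 / 5)) ^ 2) by nra. rewrite Rpow_mult_distr, Hss in *. lra.
  - assert (HLs : 0 < L * sqrt (3 / 5)) by nra.
    assert ((L * sqrt (3 / 5)) ^ 2 = L ^ 2 * (3 / 5)) by now rewrite Rpow_mult_distr, Hss.
    nra.
Qed.

Lemma is_derive_zero_const (f : R -> R) : (forall t, is_derive f t 0) -> forall t, f t = f 0.
Proof.
  intros Hf t. destruct (MVT_gen f 0 t (fun _ => 0)) as [c [_ Hc]].
  - intros; apply Hf.
  - intros x _. apply continuity_pt_filterlim, (ex_derive_continuous f). eexists; apply Hf.
  - lra.
Qed.

(* The separatrix is parametrized by [w = G_1 cot g_1]. *)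
Definition on_curve (Gam w G g : R) : Prop :=
  0 < G /\ 3 * G ^ 2 = 2 * w ^ 2 + 5 * Gam ^ 2 /\ 0 < sin g /\ G * cos g = w * sin g.

Lemma on_curve_trig Gam w G g :
  on_curve Gam w G g ->
  sin g ^ 2 = G ^ 2 / (G ^ 2 + w ^ 2) /\ sin g * cos g = w * G / (G ^ 2 + w ^ 2).
Proof.
  intros [HG [_ [Hs Hc]]].
  assert (H1 : sin g ^ 2 + cos g ^ 2 = 1).
  { pose proof (sin2_cos2 g). unfold Rsqr in H. lra. }
  assert (HD : 0 < G ^ 2 + w ^ 2) by nra.
  assert (Hs2 : sin g ^ 2 * (G ^ 2 + w ^ 2) = G ^ 2).
  { replace (sin g ^ 2 * (G ^ 2 + w ^ 2)) with (G ^ 2 * sin g ^ 2 + (w * sin g) ^ 2) by ring.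
    rewrite <- Hc. replace (G ^ 2 * sin g ^ 2 + (G * cos g) ^ 2) with
      (G ^ 2 * (sin g ^ 2 + cos g ^ 2)) by ring. rewrite H1. ring. }
  split.
  - apply Rmult_eq_reg_r with (G ^ 2 + w ^ 2); [|lra]. rewrite Hs2. field. lra.
  - apply Rmult_eq_reg_r with (G * (G ^ 2 + w ^ 2)); [|nra].
    replace (sin g * cos g * (G * (G ^ 2 + w ^ 2))) with
      (G * cos g * sin g * (G ^ 2 + w ^ 2)) by ring.
    rewrite Hc. replace (w * sin g * sin g * (G ^ 2 + w ^ 2)) with
      (w * (sin g ^ 2 * (G ^ 2 + w ^ 2))) by ring. rewrite Hs2. field. lra.
Qed.

Lemma on_curve_constraint Gam w G g :
  on_curve Gam w G g -> (1 - Gam ^ 2 / G ^ 2) * sin g ^ 2 = 2 / 5.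
Proof.
  intros H. destruct (on_curve_trig _ _ _ _ H) as [Hs _]. destruct H as [HG [HE _]].
  rewrite Hs. assert (HD : 0 < G ^ 2 + w ^ 2) by nra.
  replace ((1 - Gam ^ 2 / G ^ 2) * (G ^ 2 / (G ^ 2 + w ^ 2))) with
    ((G ^ 2 - Gam ^ 2) / (G ^ 2 + w ^ 2)) by (field; lra).
  apply Rmult_eq_reg_r with (G ^ 2 + w ^ 2); [|lra]. field_simplify; lra.
Qed.

(** The bracket in [H0] is zero on the curve, so the derivative of the factor [1 - G ^ 2 / L ^ 2]
    contributes nothing and only that of the bracket survives. *)
Lemma H0_derive_G L Gam w G g :
  0 < L -> on_curve Gam w G g ->
  Derive (fun G => H0 L g G Gam) G =
  - 10 * (1 - G ^ 2 / L ^ 2) * Gam ^ 2 / (G * (G ^ 2 + w ^ 2)).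
Proof.
  intros HL Hc. assert (Hk := on_curve_constraint _ _ _ _ Hc).
  destruct (on_curve_trig _ _ _ _ Hc) as [Hs _]. destruct Hc as [HG [HE _]].
  assert (HD : 0 < G ^ 2 + w ^ 2) by nra.
  replace (- 10 * (1 - G ^ 2 / L ^ 2) * Gam ^ 2 / (G * (G ^ 2 + w ^ 2))) with
    (- (2 * G / L ^ 2) * (2 - 5 * ((1 - Gam ^ 2 / G ^ 2) * sin g ^ 2))
     - (1 - G ^ 2 / L ^ 2) * (10 * Gam ^ 2 / G ^ 3) * sin g ^ 2).
  - apply is_derive_unique. unfold H0. auto_derive.
    + repeat split; nra.
    + field. split; lra.
  - rewrite Hk, Hs. field. repeat split; lra.
Qed.

Lemma H0_derive_g L Gam w G g :
  0 < L -> on_curve Gam w G g ->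
  - Derive (fun g => H0 L g G Gam) g = 4 * (1 - G ^ 2 / L ^ 2) * (w / G).
Proof.
  intros HL Hc.
  destruct (on_curve_trig _ _ _ _ Hc) as [_ Hs]. destruct Hc as [HG [HE _]].
  assert (HD : 0 < G ^ 2 + w ^ 2) by nra.
  assert (Hd : Derive (fun g => H0 L g G Gam) g =
    - (1 - G ^ 2 / L ^ 2) * 10 * (1 - Gam ^ 2 / G ^ 2) * (sin g * cos g)).
  { apply is_derive_unique. unfold H0. auto_derive; [exact I | field; split; lra]. }
  rewrite Hd, Hs.
  replace (Gam ^ 2) with ((3 * G ^ 2 - 2 * w ^ 2) / 5) by lra.
  field. repeat split; lra.
Qed.

(** Since w' = 6 (1 - G^2 / L^2) along the flow, the first term is the time derivative of
    [atan (w / Gam)]; the second is a uniform drift. This is where the formula [sep_gam] comes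
    from. *)
Lemma H0_derive_Gam L Gam w G g :
  0 < L -> 0 < Gam -> on_curve Gam w G g ->
  Derive (fun Y => H0 L g G Y) Gam =
  6 * (1 - G ^ 2 / L ^ 2) * Gam / (w ^ 2 + Gam ^ 2) - 2 * Gam / L ^ 2.
Proof.
  intros HL HGam Hc.
  destruct (on_curve_trig _ _ _ _ Hc) as [Hs _]. destruct Hc as [HG [HE _]].
  assert (HD : G ^ 2 + w ^ 2 = 5 / 3 * (w ^ 2 + Gam ^ 2)) by lra.
  assert (HD2 : 0 < w ^ 2 + Gam ^ 2) by nra.
  assert (Hd : Derive (fun Y => H0 L g G Y) Gam =
    (1 - G ^ 2 / L ^ 2) * (10 * Gam / G ^ 2) * sin g ^ 2 - 2 * Gam / L ^ 2).
  { apply is_derive_unique. unfold H0. auto_derive; [exact I | field; split; lra]. }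
  rewrite Hd, Hs, HD. field. repeat split; lra.
Qed.

(** * The explicit solution *)

(** The value of |w| at which G_1 would reach L_1. With the root written this way, [2 * sep_W] is
    the root that appears in [sep_nu]. *)
Definition sep_W (L Gam : R) : R := sqrt (6 * L ^ 2 - 10 * Gam ^ 2) / 2.
Definition sep_k (L Gam : R) : R := 4 * sep_W L Gam / L ^ 2.
Definition sep_w (L Gam t : R) : R := sep_W L Gam * tgh (sep_k L Gam * t).
Definition sep_G (L Gam t : R) : R := sqrt ((2 * sep_w L Gam t ^ 2 + 5 * Gam ^ 2) / 3).
(** The branch of the arc cotangent of w / G_1 with values in ]0, pi[, smooth through w = 0. *)
Definition sep_g (L Gam t : R) : R := PI / 2 - atan (sep_w L Gam t / sep_G L Gam t).
Definition sep_gam (L Gam gam0 t : R) : R :=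
  gam0 + atan (sep_w L Gam t / Gam) - 2 * Gam / L ^ 2 * t.

Definition sep_motion (L Gam gam0 : R) : motion :=
  Motion (sep_g L Gam) (sep_G L Gam) (sep_gam L Gam gam0).

Lemma sep_W_pos L Gam : 5 * Gam ^ 2 < 3 * L ^ 2 -> 0 < sep_W L Gam.
Proof. intros H. apply Rdiv_lt_0_compat; [apply sqrt_lt_R0; lra | lra]. Qed.

Lemma sep_W_sqr L Gam :
  5 * Gam ^ 2 < 3 * L ^ 2 -> 2 * sep_W L Gam ^ 2 = 3 * L ^ 2 - 5 * Gam ^ 2.
Proof.
  intros H. unfold sep_W.
  replace (2 * (sqrt (6 * L ^ 2 - 10 * Gam ^ 2) / 2) ^ 2) with
    (sqrt (6 * L ^ 2 - 10 * Gam ^ 2) ^ 2 / 2) by field.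
  rewrite pow2_sqrt by lra. field.
Qed.

Lemma sep_k_pos L Gam : 0 < L -> 5 * Gam ^ 2 < 3 * L ^ 2 -> 0 < sep_k L Gam.
Proof.
  intros HL H. pose proof (sep_W_pos L Gam H).
  apply Rdiv_lt_0_compat; [lra | apply pow_lt, HL].
Qed.

Lemma sep_G_sqr L Gam t : 3 * sep_G L Gam t ^ 2 = 2 * sep_w L Gam t ^ 2 + 5 * Gam ^ 2.
Proof. unfold sep_G. rewrite pow2_sqrt by nra. field. Qed.

Lemma sep_G_pos L Gam t : 0 < Gam -> 0 < sep_G L Gam t.
Proof. intros H. apply sqrt_lt_R0. nra. Qed.

Lemma sep_w_gap L Gam t :
  sep_W L Gam ^ 2 - sep_w L Gam t ^ 2 = sep_W L Gam ^ 2 * sech (sep_k L Gam * t) ^ 2.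
Proof. rewrite sech_tgh. unfold sep_w. ring. Qed.

(** The square on the right lets [ecc1] be extracted without a root: the eccentricity itself is
    proportional to sech. *)
Lemma sep_ecc L Gam t :
  0 < L -> 5 * Gam ^ 2 < 3 * L ^ 2 ->
  1 - sep_G L Gam t ^ 2 / L ^ 2 = 2 / 3 * (sep_W L Gam * sech (sep_k L Gam * t) / L) ^ 2.
Proof.
  intros HL H. pose proof (sep_W_sqr L Gam H) as HW. pose proof (sep_G_sqr L Gam t) as HG.
  pose proof (sep_w_gap L Gam t) as Hw.
  replace (2 / 3 * (sep_W L Gam * sech (sep_k L Gam * t) / L) ^ 2) with
    (2 / 3 * (sep_W L Gam ^ 2 * sech (sep_k L Gam * t) ^ 2) / L ^ 2) by (field; lra).
  rewrite <- Hw.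
  apply Rmult_eq_reg_r with (L ^ 2); [|apply pow_nonzero; lra].
  replace ((1 - sep_G L Gam t ^ 2 / L ^ 2) * L ^ 2) with (L ^ 2 - sep_G L Gam t ^ 2) by (field; lra).
  replace (2 / 3 * (sep_W L Gam ^ 2 - sep_w L Gam t ^ 2) / L ^ 2 * L ^ 2) with
    (2 / 3 * (sep_W L Gam ^ 2 - sep_w L Gam t ^ 2)) by (field; lra).
  lra.
Qed.

Lemma sep_g_trig L Gam t :
  0 < Gam ->
  sin (sep_g L Gam t) = sep_G L Gam t / sqrt (sep_G L Gam t ^ 2 + sep_w L Gam t ^ 2) /\
  cos (sep_g L Gam t) = sep_w L Gam t / sqrt (sep_G L Gam t ^ 2 + sep_w L Gam t ^ 2).
Proof.
  intros HGam. pose proof (sep_G_pos L Gam t HGam) as HG.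
  unfold sep_g. rewrite sin_shift, cos_shift, cos_atan, sin_atan.
  set (G := sep_G L Gam t) in *. set (w := sep_w L Gam t).
  assert (HD : 0 < G ^ 2 + w ^ 2) by nra.
  assert (Hs : 0 < sqrt (G ^ 2 + w ^ 2)) by now apply sqrt_lt_R0.
  replace (sqrt (1 + (w / G)²)) with (sqrt (G ^ 2 + w ^ 2) / G).
  - split; field; lra.
  - replace (1 + (w / G)²) with ((G ^ 2 + w ^ 2) / G ^ 2) by (unfold Rsqr; field; lra).
    rewrite sqrt_div_alt by (apply pow_lt, HG). rewrite sqrt_pow2 by lra. reflexivity.
Qed.

Lemma sep_on_curve L Gam t :
  0 < Gam -> on_curve Gam (sep_w L Gam t) (sep_G L Gam t) (sep_g L Gam t).
Proof.
  intros HGam. pose proof (sep_G_pos L Gam t HGam) as HG.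
  destruct (sep_g_trig L Gam t HGam) as [Hs Hc].
  assert (HD : 0 < sqrt (sep_G L Gam t ^ 2 + sep_w L Gam t ^ 2)) by (apply sqrt_lt_R0; nra).
  split; [exact HG|]. split; [apply sep_G_sqr|]. split.
  - rewrite Hs. now apply Rdiv_lt_0_compat.
  - rewrite Hs, Hc. field. lra.
Qed.

Lemma sep_w_derive L Gam t :
  0 < L -> 5 * Gam ^ 2 < 3 * L ^ 2 ->
  is_derive (sep_w L Gam) t (6 * (1 - sep_G L Gam t ^ 2 / L ^ 2)).
Proof.
  intros HL H. pose proof (sep_W_pos L Gam H).
  replace (6 * (1 - sep_G L Gam t ^ 2 / L ^ 2)) with
    (sep_W L Gam * (sep_k L Gam * (1 - tgh (sep_k L Gam * t) ^ 2))).
  - apply (is_derive_scal (fun t => tgh (sep_k L Gam * t))), is_derive_tgh_scale.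
  - rewrite <- sech_tgh, sep_ecc by assumption. unfold sep_k at 1. field. lra.
Qed.

Lemma sep_is_separatrix L Gam gam0 :
  0 < L -> 0 < Gam -> 5 * Gam ^ 2 < 3 * L ^ 2 ->
  is_separatrix L Gam gam0 (sep_motion L Gam gam0).
Proof.
  intros HL HGam H. pose proof (sep_W_pos L Gam H) as HW.
  assert (Hw0 : sep_w L Gam 0 = 0).
  { unfold sep_w, tgh. rewrite Rmult_0_r, sinh_0. unfold Rdiv; ring. }
  split; [|split; [|split]].
  - intros t. simpl.
    pose proof (sep_on_curve L Gam t HGam) as Hon.
    rewrite (H0_derive_G L Gam _ _ _ HL Hon), (H0_derive_g L Gam _ _ _ HL Hon),
      (H0_derive_Gam L Gam _ _ _ HL HGam Hon).
    pose proof (sep_w_derive L Gam t HL H) as Hw.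
    pose proof (sep_G_sqr L Gam t) as HGs. pose proof (sep_G_pos L Gam t HGam) as HG.
    assert (HGd : is_derive (sep_G L Gam) t
      (4 * (1 - sep_G L Gam t ^ 2 / L ^ 2) * (sep_w L Gam t / sep_G L Gam t))).
    { assert (Hex : ex_derive (sep_w L Gam) t) by (eexists; exact Hw).
      assert (HD : Derive (fun x : R => sep_w L Gam x) t = 6 * (1 - sep_G L Gam t ^ 2 / L ^ 2))
        by (apply is_derive_unique; exact Hw).
      apply (is_derive_ext (fun t => sqrt ((2 * sep_w L Gam t ^ 2 + 5 * Gam ^ 2) / 3)));
        [reflexivity|].
      auto_derive.
      - split; [exact Hex|]. split; [nra | exact I].
      - rewrite HD.
        replace (sqrt _) with (sep_G L Gam t).
        + field. split; lra.
        + unfold sep_G. now f_equal. }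
    assert (HD : 0 < sep_G L Gam t ^ 2 + sep_w L Gam t ^ 2) by nra.
    assert (HD2 : 0 < sep_w L Gam t ^ 2 + Gam ^ 2) by nra.
    set (e := 1 - sep_G L Gam t ^ 2 / L ^ 2) in *.
    assert (Dw : Derive (fun x : R => sep_w L Gam x) t = 6 * e)
      by (apply is_derive_unique; exact Hw).
    assert (DG : Derive (fun x : R => sep_G L Gam x) t = 4 * e * (sep_w L Gam t / sep_G L Gam t))
      by (apply is_derive_unique; exact HGd).
    assert (Ew : ex_derive (fun x : R => sep_w L Gam x) t) by (eexists; exact Hw).
    assert (EG : ex_derive (fun x : R => sep_G L Gam x) t) by (eexists; exact HGd).
    clearbody e.
    split; [|split; [exact HGd|]].
    + apply (is_derive_ext (fun t => PI / 2 - atan (sep_w L Gam t / sep_G L Gam t)));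
        [reflexivity|].
      auto_derive.
      * repeat split; try assumption; lra.
      * rewrite Dw, DG.
        set (G := sep_G L Gam t) in *. set (w := sep_w L Gam t) in *. clearbody G w.
        replace (Gam ^ 2) with ((3 * G ^ 2 - 2 * w ^ 2) / 5) by lra.
        field. repeat split; lra.
    + apply (is_derive_ext (fun t => gam0 + atan (sep_w L Gam t / Gam) - 2 * Gam / L ^ 2 * t));
        [reflexivity|].
      auto_derive.
      * repeat split; try assumption.
      * rewrite Dw. set (w := sep_w L Gam t) in *. clearbody w. field. repeat split; lra.
  - intros t. simpl. pose proof (sep_on_curve L Gam t HGam) as Hon.
    split; [apply (on_curve_constraint _ _ _ _ Hon)|].
    pose proof (sep_G_sqr L Gam t) as HGs. pose proof (sep_G_pos L Gam t HGam) as HG.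
    pose proof (sep_W_sqr L Gam H) as HWs. pose proof (sep_w_gap L Gam t) as Hgap.
    pose proof (sech_pos (sep_k L Gam * t)) as Hse.
    assert (0 < sep_W L Gam ^ 2 * sech (sep_k L Gam * t) ^ 2)
      by (apply Rmult_lt_0_compat; now apply pow_lt).
    split; [split; nra|].
    unfold sep_g. pose proof (atan_bound (sep_w L Gam t / sep_G L Gam t)). lra.
  - simpl. unfold sep_g. rewrite Hw0. unfold Rdiv at 2. rewrite Rmult_0_l, atan_0. ring.
  - simpl. unfold sep_gam. rewrite Hw0. unfold Rdiv at 1. rewrite Rmult_0_l, atan_0. ring.
Qed.

(* [ln ((W + w) / (W - w))] linearizes the flow. *)
Lemma riccati_unique (w : R -> R) W k :
  0 < W -> (forall t, - W < w t < W) -> w 0 = 0 ->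
  (forall t, is_derive w t (k / W * (W ^ 2 - w t ^ 2))) ->
  forall t, w t = W * tgh (k * t).
Proof.
  intros HW Hb H0 Hd t.
  set (y := fun t => ln (W + w t) - ln (W - w t) - 2 * k * t).
  assert (Hy : forall t, is_derive y t 0).
  { intros s. specialize (Hb s). specialize (Hd s). unfold y.
    assert (Dw : Derive (fun x : R => w x) s = k / W * (W ^ 2 - w s ^ 2))
      by (apply is_derive_unique; exact Hd).
    assert (Ew : ex_derive (fun x : R => w x) s) by (eexists; exact Hd).
    auto_derive.
    - repeat split; try assumption; lra.
    - rewrite Dw. field. repeat split; lra. }
  assert (Ht := is_derive_zero_const y Hy t). unfold y in Ht. rewrite H0 in Ht.
  rewrite Rplus_0_r, Rminus_0_r in Ht.
  pose proof (Hb t) as Hbt.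
  assert (He : W + w t = (W - w t) * (exp (k * t) * exp (k * t))).
  { rewrite <- exp_plus, <- (exp_ln (W + w t)), <- (exp_ln (W - w t)) at 1 by lra.
    rewrite <- exp_plus. f_equal. lra. }
  unfold tgh, sinh, cosh. rewrite exp_Ropp.
  pose proof (exp_pos (k * t)) as Hp. set (e := exp (k * t)) in *.
  assert (He2 : 0 < e * e + 1) by nra.
  apply Rmult_eq_reg_r with (e * e + 1); [|lra].
  replace (W * ((e - / e) / 2 / ((e + / e) / 2)) * (e * e + 1)) with (W * (e * e - 1)).
  - lra.
  - field. split; [lra|]. nra.
Qed.

(** The constraint reduces the motion to the single unknown w, whose equation [riccati_unique]
    integrates. Then the conic and [0 < G] give [G], the range ]0, pi[ gives [g] through its
    cotangent, and [gam] follows because two solutions now share the same velocity and the same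
    initial value. *)
Lemma separatrix_unique L Gam gam0 h :
  0 < L -> 0 < Gam -> 5 * Gam ^ 2 < 3 * L ^ 2 ->
  is_separatrix L Gam gam0 h -> h = sep_motion L Gam gam0.
Proof.
  intros HL HGam H Hh. pose proof (sep_is_separatrix L Gam gam0 HL HGam H) as Hsep.
  destruct h as [g G gam]. destruct Hh as [Hd [Hc [Hg0 Hgam0]]]. simpl in *.
  set (w := fun t => G t * (cos (g t) / sin (g t))).
  assert (Hsin : forall t, 0 < sin (g t)).
  { intros t. destruct (Hc t) as [_ [_ Hg]]. apply sin_gt_0; lra. }
  assert (Hon : forall t, on_curve Gam (w t) (G t) (g t)).
  { intros t. destruct (Hc t) as [Hcon [HG Hg]]. specialize (Hsin t).
    split; [lra|]. split; [|split; [exact Hsin|]].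
    - assert (Hsc : cos (g t) ^ 2 = 1 - sin (g t) ^ 2).
      { pose proof (sin2_cos2 (g t)) as Hp. unfold Rsqr in Hp. lra. }
      unfold w. rewrite Rpow_mult_distr.
      replace ((cos (g t) / sin (g t)) ^ 2) with (cos (g t) ^ 2 / sin (g t) ^ 2) by (field; lra).
      rewrite Hsc.
      assert (Hcon' : (G t ^ 2 - Gam ^ 2) * sin (g t) ^ 2 = 2 / 5 * G t ^ 2).
      { rewrite <- Hcon. field. lra. }
      apply Rmult_eq_reg_r with (sin (g t) ^ 2); [|apply pow_nonzero; lra].
      replace ((2 * (G t ^ 2 * ((1 - sin (g t) ^ 2) / sin (g t) ^ 2)) + 5 * Gam ^ 2) * sin (g t) ^ 2)
        with (2 * G t ^ 2 * (1 - sin (g t) ^ 2) + 5 * Gam ^ 2 * sin (g t) ^ 2) by (field; lra).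
      lra.
    - unfold w. field. lra. }
  assert (HWs := sep_W_sqr L Gam H). assert (HW := sep_W_pos L Gam H).
  assert (HwE : forall t, w t = sep_w L Gam t).
  { apply riccati_unique; [exact HW | | |].
    (* The bound G < L_1 is precisely |w| < W, which keeps both logarithms in [riccati_unique]
       defined. *)
    - intros t. destruct (Hc t) as [_ [HG _]]. destruct (Hon t) as [HG0 [HE _]].
      assert (w t ^ 2 < sep_W L Gam ^ 2) by nra. nra.
    - unfold w. rewrite Hg0, cos_PI2. unfold Rdiv; ring.
    - intros t. specialize (Hon t). specialize (Hsin t).
      destruct (Hd t) as [Hdg [HdG _]].
      rewrite (H0_derive_G L Gam (w t) _ _ HL Hon) in Hdg.
      rewrite (H0_derive_g L Gam (w t) _ _ HL Hon) in HdG.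
      destruct (on_curve_trig _ _ _ _ Hon) as [Hs2 _].
      destruct Hon as [HG0 [HE [_ Hcs]]].
      assert (HD : 0 < G t ^ 2 + w t ^ 2) by nra.
      assert (Eg : ex_derive (fun x : R => g x) t) by (eexists; exact Hdg).
      assert (EG : ex_derive (fun x : R => G x) t) by (eexists; exact HdG).
      apply is_derive_unique in Hdg as Dg. apply is_derive_unique in HdG as DG.
      change (Derive (fun x : R => g x) t = - 10 * (1 - G t ^ 2 / L ^ 2) * Gam ^ 2 / (G t * (G t ^ 2 + w t ^ 2))) in Dg.
      change (Derive (fun x : R => G x) t = 4 * (1 - G t ^ 2 / L ^ 2) * (w t / G t)) in DG.
      apply (is_derive_ext (fun t => G t * (cos (g t) / sin (g t)))); [reflexivity|].
      auto_derive.
      + repeat split; try assumption. lra.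
      + rewrite Dg, DG.
        assert (Hcw : cos (g t) = w t * sin (g t) / G t) by (rewrite <- Hcs; field; lra).
        rewrite Hcw.
        replace (sep_k L Gam / sep_W L Gam * (sep_W L Gam ^ 2 - w t ^ 2)) with
          (6 * (1 - G t ^ 2 / L ^ 2)).
        * set (W := w t) in *. set (s := sin (g t)) in *. set (GG := G t) in *. clearbody W s GG.
          replace (Gam ^ 2) with ((3 * GG ^ 2 - 2 * W ^ 2) / 5) by lra.
          field. repeat split; lra.
        * unfold sep_k.
          replace (sep_W L Gam ^ 2) with ((3 * L ^ 2 - 5 * Gam ^ 2) / 2) by lra.
          replace (w t ^ 2) with ((3 * G t ^ 2 - 5 * Gam ^ 2) / 2) by lra.
          field. split; lra. }
  assert (HGE : G = sep_G L Gam).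
  { apply functional_extensionality; intros t. destruct (Hon t) as [HG [HE _]].
    unfold sep_G. rewrite <- HwE, <- HE.
    replace (3 * G t ^ 2 / 3) with (G t ^ 2) by field. rewrite sqrt_pow2; lra. }
  assert (HgE : g = sep_g L Gam).
  { apply functional_extensionality; intros t. unfold sep_g.
    rewrite <- HwE, <- HGE. destruct (Hc t) as [_ [HG Hg]]. specialize (Hsin t).
    replace (w t / G t) with (tan (PI / 2 - g t)).
    - rewrite atan_tan by lra. ring.
    - unfold tan. rewrite sin_shift, cos_shift. unfold w. field. lra. }
  assert (HgamE : gam = sep_gam L Gam gam0).
  { destruct Hsep as [Hsd [_ [_ Hsg]]]. simpl in Hsd, Hsg.
    apply functional_extensionality; intros t.
    assert (Hdiff : forall t, is_derive (fun t => gam t - sep_gam L Gam gam0 t) t 0).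
    { intros s. destruct (Hd s) as [_ [_ H1]]. destruct (Hsd s) as [_ [_ H2]].
      rewrite HGE, HgE in H1.
      assert (H3 := is_derive_minus _ _ _ _ _ H1 H2).
      rewrite minus_eq_zero in H3. exact H3. }
    assert (Hz := is_derive_zero_const _ Hdiff t). simpl in Hz.
    rewrite Hgam0, Hsg in Hz. lra. }
  unfold sep_motion. now rewrite HGE, HgE, HgamE.
Qed.

Lemma separatrix_eq L Gam gam0 :
  0 < L -> 0 < Gam -> 5 * Gam ^ 2 < 3 * L ^ 2 ->
  separatrix L Gam gam0 = sep_motion L Gam gam0.
Proof.
  intros HL HGam H. apply separatrix_unique; try assumption.
  apply (epsilon_spec _ (is_separatrix L Gam gam0)). eexists. now apply sep_is_separatrix.
Qed.

(** * The Melnikov potential *)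

Lemma atan_ratio_trig w c :
  0 < c -> cos (atan (w / c)) = c / sqrt (w ^ 2 + c ^ 2) /\
           sin (atan (w / c)) = w / sqrt (w ^ 2 + c ^ 2).
Proof.
  intros Hc. rewrite cos_atan, sin_atan.
  assert (Hs : 0 < sqrt (w ^ 2 + c ^ 2)) by (apply sqrt_lt_R0; nra).
  replace (sqrt (1 + (w / c)²)) with (sqrt (w ^ 2 + c ^ 2) / c).
  - split; field; lra.
  - replace (1 + (w / c)²) with ((w ^ 2 + c ^ 2) / c ^ 2) by (unfold Rsqr; field; lra).
    rewrite sqrt_div_alt by (apply pow_lt, Hc). rewrite sqrt_pow2 by lra. reflexivity.
Qed.

(** Once cos^2 g is replaced by 1 - sin^2 g, the angle [g] enters only through the product sin^2 i
    sin^2 g, which is 2/5 on the curve; what remains is a polynomial in w^2. *)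
Lemma coefA_on_curve L Gam w G g :
  0 < L -> on_curve Gam w G g ->
  coefA L g G Gam = (4 * w ^ 2 + 15 * Gam ^ 2 - 7 * L ^ 2) / L ^ 2.
Proof.
  intros HL Hon. pose proof (on_curve_constraint _ _ _ _ Hon) as Hc.
  destruct Hon as [HG [HE _]].
  assert (H1 : cos g ^ 2 = 1 - sin g ^ 2).
  { pose proof (sin2_cos2 g). unfold Rsqr in H. lra. }
  unfold coefA, sin2_i. rewrite H1.
  replace (G ^ 2 / L ^ 2 * (5 * (1 - Gam ^ 2 / G ^ 2) * (-7 * (1 - sin g ^ 2) + 6) - 3)
    - 35 * sin g ^ 2 * (1 - Gam ^ 2 / G ^ 2) + 7) with
    (G ^ 2 / L ^ 2 * (35 * ((1 - Gam ^ 2 / G ^ 2) * sin g ^ 2) - 5 * (1 - Gam ^ 2 / G ^ 2) - 3)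
     - 35 * ((1 - Gam ^ 2 / G ^ 2) * sin g ^ 2) + 7) by ring.
  rewrite Hc. replace (w ^ 2) with ((3 * G ^ 2 - 5 * Gam ^ 2) / 2) by lra.
  field. split; lra.
Qed.

Lemma coefB_on_curve L Gam w G g :
  0 < L -> on_curve Gam w G g ->
  coefB L g G Gam = (8 / 3 * w ^ 2 - 25 / 3 * Gam ^ 2 + 7 * L ^ 2) / L ^ 2.
Proof.
  intros HL Hon. pose proof (on_curve_constraint _ _ _ _ Hon) as Hc.
  destruct Hon as [HG [HE _]].
  assert (H1 : cos g ^ 2 = 1 - sin g ^ 2).
  { pose proof (sin2_cos2 g). unfold Rsqr in H. lra. }
  unfold coefB, sin2_i. rewrite H1.
  replace (G ^ 2 / L ^ 2 * (5 * (1 - Gam ^ 2 / G ^ 2) * (7 * (1 - sin g ^ 2) - 4) + 3)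
    + 35 * sin g ^ 2 * (1 - Gam ^ 2 / G ^ 2) - 7) with
    (G ^ 2 / L ^ 2 * (15 * (1 - Gam ^ 2 / G ^ 2) - 35 * ((1 - Gam ^ 2 / G ^ 2) * sin g ^ 2) + 3)
     + 35 * ((1 - Gam ^ 2 / G ^ 2) * sin g ^ 2) - 7) by ring.
  rewrite Hc. replace (w ^ 2) with ((3 * G ^ 2 - 5 * Gam ^ 2) / 2) by lra.
  field. split; lra.
Qed.

(** The speed of the drift of gamma measured in the rescaled time [sep_k * t]. The product with an
    inverse suits the proof of analyticity, which composes with the inverse square root. *)
Definition sep_nu (p : R * R) : R := snd p * / sqrt (6 * fst p ^ 2 - 10 * snd p ^ 2).

Lemma sep_nu_k L Gam :
  0 < L -> 5 * Gam ^ 2 < 3 * L ^ 2 -> sep_nu (L, Gam) * sep_k L Gam = 2 * Gam / L ^ 2.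
Proof.
  intros HL H. unfold sep_nu, sep_k, sep_W; simpl fst; simpl snd.
  assert (0 < sqrt (6 * L ^ 2 - 10 * Gam ^ 2)) by (apply sqrt_lt_R0; lra).
  field. split; lra.
Qed.

Lemma sep_nu_W L Gam :
  5 * Gam ^ 2 < 3 * L ^ 2 -> sep_nu (L, Gam) = Gam / (2 * sep_W L Gam).
Proof.
  intros H. unfold sep_nu, sep_W; simpl fst; simpl snd.
  assert (0 < sqrt (6 * L ^ 2 - 10 * Gam ^ 2)) by (apply sqrt_lt_R0; lra).
  field. lra.
Qed.

(** All roots disappear for one reason: G^2 + w^2 = (5/3) (w^2 + Gamma^2). The sines and cosines of
    [g] and of [atan (w / Gam)] thus share the denominator [rho] up to a constant, and after
    expansion the numerator is divisible by [rho ^ 2]. The factor [G] in sin g cancels the one in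
    cos i. *)
Lemma H2_along_separatrix a2 e2 mu1 M1 L Gam gam0 t :
  0 < L -> 0 < Gam -> 5 * Gam ^ 2 < 3 * L ^ 2 ->
  H2_along a2 e2 mu1 M1 L Gam (sep_motion L Gam gam0) t =
  Aoct a2 e2 mu1 M1 L * (sqrt (2 / 3) / sqrt (5 / 3)) * sep_W L Gam / (3 * L ^ 3) *
  (sech (sep_k L Gam * t) *
   ((21 * L ^ 2 - 25 * Gam ^ 2 - 12 * sep_W L Gam ^ 2 * tgh (sep_k L Gam * t) ^ 2)
      * sin (gam0 - sep_nu (L, Gam) * (sep_k L Gam * t))
    + 20 * Gam * sep_W L Gam * tgh (sep_k L Gam * t)
      * cos (gam0 - sep_nu (L, Gam) * (sep_k L Gam * t)))).
Proof.
  intros HL HGam H. unfold H2_along, H2, sep_motion, cos_i; simpl mot_g1; simpl mot_G1; simpl mot_gam.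
  pose proof (sep_on_curve L Gam t HGam) as Hon.
  rewrite (coefA_on_curve L Gam _ _ _ HL Hon), (coefB_on_curve L Gam _ _ _ HL Hon).
  destruct (sep_g_trig L Gam t HGam) as [Hs Hc]. rewrite Hs, Hc.
  pose proof (sep_G_pos L Gam t HGam) as HG. pose proof (sep_G_sqr L Gam t) as HGs.
  pose proof (sep_W_pos L Gam H) as HW. pose proof (sech_pos (sep_k L Gam * t)) as Hse.
  assert (He : ecc1 L (sep_G L Gam t) =
    sqrt (2 / 3) * (sep_W L Gam * sech (sep_k L Gam * t) / L)).
  { unfold ecc1. rewrite sep_ecc by assumption. rewrite sqrt_mult by (try apply pow2_ge_0; lra).
    rewrite sqrt_pow2; [reflexivity|]. left. apply Rdiv_lt_0_compat; [nra | exact HL]. }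
  rewrite He.
  replace (sep_nu (L, Gam) * (sep_k L Gam * t)) with (2 * Gam / L ^ 2 * t)
    by (rewrite <- sep_nu_k by assumption; ring).
  unfold sep_gam.
  replace (gam0 + atan (sep_w L Gam t / Gam) - 2 * Gam / L ^ 2 * t) with
    ((gam0 - 2 * Gam / L ^ 2 * t) + atan (sep_w L Gam t / Gam)) by ring.
  set (th := gam0 - 2 * Gam / L ^ 2 * t).
  destruct (atan_ratio_trig (sep_w L Gam t) Gam HGam) as [Hca Hsa].
  rewrite sin_plus, cos_plus, Hca, Hsa.
  set (rho := sqrt (sep_w L Gam t ^ 2 + Gam ^ 2)) in *.
  assert (Hr : 0 < rho) by (apply sqrt_lt_R0; nra).
  assert (Hr2 : rho ^ 2 = sep_w L Gam t ^ 2 + Gam ^ 2) by (apply pow2_sqrt; nra).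
  assert (H53 : 0 < sqrt (5 / 3)) by (apply sqrt_lt_R0; lra).
  replace (sqrt (sep_G L Gam t ^ 2 + sep_w L Gam t ^ 2)) with (sqrt (5 / 3) * rho).
  2:{ unfold rho. rewrite <- sqrt_mult by nra. f_equal. lra. }
  replace (12 * sep_W L Gam ^ 2 * tgh (sep_k L Gam * t) ^ 2) with (12 * sep_w L Gam t ^ 2)
    by (unfold sep_w; ring).
  replace (20 * Gam * sep_W L Gam * tgh (sep_k L Gam * t)) with (20 * Gam * sep_w L Gam t)
    by (unfold sep_w; ring).
  set (w := sep_w L Gam t) in *. set (G := sep_G L Gam t) in *.
  set (A := Aoct a2 e2 mu1 M1 L). set (c53 := sqrt (5 / 3)) in *. set (c23 := sqrt (2 / 3)).
  set (W := sep_W L Gam) in *. set (S := sech (sep_k L Gam * t)) in *.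
  set (sn := sin th). set (cs := cos th).
  clearbody rho w G A c53 c23 W S sn cs.
  transitivity (A * c23 * W * S / (L ^ 3 * c53) *
    ((w * (cs * Gam - sn * w) * (4 * w ^ 2 + 15 * Gam ^ 2 - 7 * L ^ 2)
      + Gam * (sn * Gam + cs * w) * (8 / 3 * w ^ 2 - 25 / 3 * Gam ^ 2 + 7 * L ^ 2)) / rho ^ 2)).
  - field. repeat split; lra.
  - rewrite Hr2. field. repeat split; nra.
Qed.

Definition mel_const (a2 e2 mu1 M1 : R) : R :=
  - (15 / 64) / ((mu1 ^ 2 * M1) ^ 3 * a2 ^ 4) * (e2 / Rpower (1 - e2 ^ 2) (5 / 2))
  * (sqrt (2 / 3) / sqrt (5 / 3)) / 6.

(** [axis1 ^ 3] contributes L_1^6, the prefactor W / (3 L_1^3) and the factor 2 / k equals L_1^2 /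
    (2 W); W cancels, leaving L_1^5 and the 1/6 of [mel_const]. The quadratic factor is positive on
    the domain, so for [c <> 0] the zeros are those of [sech_hat (sep_nu p)]. *)
Definition mel_amp (c : R) (p : R * R) : R :=
  c * (fst p ^ 5 * (12 * fst p ^ 2 + 3 / 2 * snd p ^ 2)) * sech_hat (sep_nu p).

Lemma is_RInt_gen_melnikov a2 e2 mu1 M1 L Gam gam0 :
  0 < a2 -> 0 < mu1 -> 0 < M1 ->
  0 < L -> 0 < Gam -> 5 * Gam ^ 2 < 3 * L ^ 2 ->
  is_RInt_gen (H2_along a2 e2 mu1 M1 L Gam (separatrix L Gam gam0))
    (Rbar_locally m_infty) (Rbar_locally p_infty)
    (mel_amp (mel_const a2 e2 mu1 M1) (L, Gam) * sin gam0).
Proof.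
  intros Ha2 Hmu1 HM1 HL HGam H. rewrite separatrix_eq by assumption.
  pose proof (sep_k_pos L Gam HL H) as Hk. pose proof (sep_W_pos L Gam H) as HW.
  assert (HI := is_RInt_gen_melnikov_kernel (21 * L ^ 2 - 25 * Gam ^ 2) (12 * sep_W L Gam ^ 2)
    (20 * Gam * sep_W L Gam) (sep_k L Gam) (sep_nu (L, Gam)) gam0 Hk).
  apply (is_RInt_gen_scal _ (Aoct a2 e2 mu1 M1 L * (sqrt (2 / 3) / sqrt (5 / 3)) * sep_W L Gam / (3 * L ^ 3))) in HI.
  replace (mel_amp (mel_const a2 e2 mu1 M1) (L, Gam) * sin gam0) with
    (Aoct a2 e2 mu1 M1 L * (sqrt (2 / 3) / sqrt (5 / 3)) * sep_W L Gam / (3 * L ^ 3) *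
    ((21 * L ^ 2 - 25 * Gam ^ 2 - 12 * sep_W L Gam ^ 2 * (1 - sep_nu (L, Gam) ^ 2) / 2
       + 20 * Gam * sep_W L Gam * sep_nu (L, Gam)) / sep_k L Gam
      * (2 * sech_hat (sep_nu (L, Gam))) * sin gam0)).
  - eapply is_RInt_gen_ext; [|exact HI].
    apply filter_forall. intros ab x _. symmetry. now apply H2_along_separatrix.
  - unfold mel_amp, mel_const, Aoct, axis1; simpl fst; simpl snd.
    replace (21 * L ^ 2 - 25 * Gam ^ 2 - 12 * sep_W L Gam ^ 2 * (1 - sep_nu (L, Gam) ^ 2) / 2
       + 20 * Gam * sep_W L Gam * sep_nu (L, Gam)) with (12 * L ^ 2 + 3 / 2 * Gam ^ 2).
    2:{ pose proof (sep_W_sqr L Gam H) as HW2. rewrite sep_nu_W by exact H.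
        replace (12 * sep_W L Gam ^ 2 * (1 - (Gam / (2 * sep_W L Gam)) ^ 2) / 2) with
          (3 * (2 * sep_W L Gam ^ 2) - 3 / 2 * Gam ^ 2) by (field; lra).
        replace (20 * Gam * sep_W L Gam * (Gam / (2 * sep_W L Gam))) with (10 * Gam ^ 2)
          by (field; lra).
        rewrite HW2. ring. }
    unfold sep_k. assert (0 < sqrt (5 / 3)) by (apply sqrt_lt_R0; lra).
    assert (Rpower (1 - e2 ^ 2) (5 / 2) <> 0) by (unfold Rpower; apply Rgt_not_eq, exp_pos).
    field. repeat split; lra.
Qed.

Lemma mel_const_neq_0 a2 e2 mu1 M1 :
  0 < a2 -> 0 < e2 -> 0 < mu1 -> 0 < M1 -> mel_const a2 e2 mu1 M1 <> 0.
Proof.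
  intros Ha2 He2 Hmu1 HM1. unfold mel_const.
  assert (0 < sqrt (5 / 3)) by (apply sqrt_lt_R0; lra).
  assert (0 < sqrt (2 / 3)) by (apply sqrt_lt_R0; lra).
  assert (0 < Rpower (1 - e2 ^ 2) (5 / 2)) by apply exp_pos.
  assert (0 < (mu1 ^ 2 * M1) ^ 3 * a2 ^ 4)
    by (repeat apply Rmult_lt_0_compat; try apply pow_lt; try apply Rmult_lt_0_compat; try apply pow_lt; lra).
  apply Rlt_not_eq.
  replace (_ / 6) with (- (15 / 64 * / ((mu1 ^ 2 * M1) ^ 3 * a2 ^ 4)
    * (e2 / Rpower (1 - e2 ^ 2) (5 / 2)) * (sqrt (2 / 3) / sqrt (5 / 3)) / 6)) by (unfold Rdiv; ring).
  apply Ropp_lt_gt_0_contravar.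
  repeat apply Rmult_lt_0_compat; try apply Rinv_0_lt_compat; lra.
Qed.

(** * The amplitude: analyticity, zeros and scaling *)

Lemma mel_amp_hanalytic c p : dom_O p -> hanalytic (mel_amp c) p.
Proof.
  destruct p as [L Gam]. intros Hp. apply dom_O_bounds in Hp as [HL [HGam H]].
  unfold mel_amp, sep_nu.
  assert (Hquad : forall a b, hanalytic (fun q : R * R => a * fst q ^ 2 + b * snd q ^ 2) (L, Gam)).
  { intros a b.
    apply (hanalytic_plus (fun q => a * fst q ^ 2) (fun q => b * snd q ^ 2));
      (apply hanalytic_mult; [apply hanalytic_const | apply hanalytic_pow]).
    - apply hanalytic_fst.
    - apply hanalytic_snd. }
  apply (hanalytic_mult (fun q => c * (fst q ^ 5 * (12 * fst q ^ 2 + 3 / 2 * snd q ^ 2)))).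
  - apply hanalytic_mult; [apply hanalytic_const|].
    apply hanalytic_mult; [apply hanalytic_pow, hanalytic_fst | apply Hquad].
  - apply (hanalytic_comp sech_hat); [|apply analytic1_sech_hat].
    apply hanalytic_mult; [apply hanalytic_snd|].
    apply (hanalytic_comp (fun y => / sqrt y) (fun q => 6 * fst q ^ 2 - 10 * snd q ^ 2)).
    + replace (fun q : R * R => 6 * fst q ^ 2 - 10 * snd q ^ 2)
        with (fun q : R * R => 6 * fst q ^ 2 + - 10 * snd q ^ 2)
        by (apply functional_extensionality; intros; ring).
      apply Hquad.
    + apply analytic1_inv_sqrt. simpl fst; simpl snd. lra.
Qed.

Lemma dom_O_open : open dom_O.
Proof.
  apply open_and.
  - apply (open_comp fst (fun x => 0 < x)); [|apply open_gt].
    intros p _. apply continuous_fst.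
  - apply open_and.
    + apply (open_comp snd (fun x => 0 < x)); [|apply open_gt].
      intros p _. apply continuous_snd.
    + apply open_ext with (fun p : R * R => 0 < fst p * sqrt (3 / 5) - snd p); [intros; lra|].
      apply (open_comp (fun p : R * R => fst p * sqrt (3 / 5) - snd p) (fun x => 0 < x)); [|apply open_gt].
      intros p _. apply (continuous_minus (fun p : R * R => fst p * sqrt (3 / 5)) snd).
      * apply (continuous_mult (fun p : R * R => fst p) (fun _ => sqrt (3 / 5)));
          [apply continuous_fst | apply continuous_const].
      * apply continuous_snd.
Qed.

(** At fixed L_1 the frequency [sep_nu] is an invertible function of Gamma, so an open set of zeros
    of the amplitude would give an interval of zeros of [sech_hat]. *)
Lemma mel_amp_zero_interior c p :
  c <> 0 -> dom_O p -> ~ locally p (fun q => mel_amp c q = 0).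
Proof.
  destruct p as [L Gam]. intros Hc Hp [eps He]. apply dom_O_bounds in Hp as [HL [HGam H]].
  (* The inverse of Gamma -> nu at fixed L_1, solved from n^2 (6 L_1^2 - 10 Gamma^2) = Gamma^2. *)
  set (N := fun n => n * L * sqrt (6 / (1 + 10 * n ^ 2))).
  assert (Hden : forall n, 0 < 1 + 10 * n ^ 2) by (intros; nra).
  assert (HN2 : forall n, N n ^ 2 * (1 + 10 * n ^ 2) = 6 * n ^ 2 * L ^ 2).
  { intros n. specialize (Hden n). unfold N. rewrite !Rpow_mult_distr, pow2_sqrt.
    - field. lra.
    - left; apply Rdiv_lt_0_compat; lra. }
  assert (Hnu : forall n, 0 < n -> sep_nu (L, N n) = n).
  { intros n Hn. specialize (Hden n). specialize (HN2 n).
    unfold sep_nu; simpl fst; simpl snd.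
    assert (Hs : 0 < sqrt (6 / (1 + 10 * n ^ 2))) by (apply sqrt_lt_R0, Rdiv_lt_0_compat; lra).
    replace (6 * L ^ 2 - 10 * N n ^ 2) with ((L * sqrt (6 / (1 + 10 * n ^ 2))) ^ 2).
    - rewrite sqrt_pow2 by nra. unfold N. field. split; lra.
    - rewrite Rpow_mult_distr, pow2_sqrt by (left; apply Rdiv_lt_0_compat; lra).
      apply Rmult_eq_reg_r with (1 + 10 * n ^ 2); [|lra].
      replace ((6 * L ^ 2 - 10 * N n ^ 2) * (1 + 10 * n ^ 2)) with
        (6 * L ^ 2 * (1 + 10 * n ^ 2) - 10 * (N n ^ 2 * (1 + 10 * n ^ 2))) by ring.
      rewrite HN2. field. lra. }
  set (n0 := sep_nu (L, Gam)).
  assert (Hsq : 0 < sqrt (6 * L ^ 2 - 10 * Gam ^ 2)) by (apply sqrt_lt_R0; lra).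
  assert (Hn0 : 0 < n0).
  { unfold n0, sep_nu; simpl. apply Rmult_lt_0_compat; [exact HGam | apply Rinv_0_lt_compat, Hsq]. }
  assert (HNn0 : N n0 = Gam).
  { assert (Hn2 : n0 ^ 2 * (6 * L ^ 2 - 10 * Gam ^ 2) = Gam ^ 2).
    { rewrite <- (pow2_sqrt (6 * L ^ 2 - 10 * Gam ^ 2)) by lra.
      unfold n0, sep_nu; simpl fst; simpl snd. field. lra. }
    specialize (HN2 n0). specialize (Hden n0).
    assert (HNp : 0 <= N n0).
    { unfold N. apply Rmult_le_pos; [nra | apply sqrt_pos]. }
    assert (HE : N n0 ^ 2 = Gam ^ 2).
    { apply Rmult_eq_reg_r with (1 + 10 * n0 ^ 2); [|lra]. rewrite HN2. lra. }
    nra. }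
  assert (Hcont : continuous N n0).
  { apply (ex_derive_continuous N). unfold N. specialize (Hden n0). auto_derive.
    split; [lra|]. split; [|exact I]. apply Rdiv_lt_0_compat; lra. }
  assert (HlocN := Hcont (fun y => Rabs (y - Gam) < eps)).
  rewrite HNn0 in HlocN.
  destruct HlocN as [del Hdel]; [exists eps; intros y Hy; exact Hy|].
  (* Capping the radius by [n0] keeps [y] positive, where [N] inverts [sep_nu]. *)
  assert (Hm : 0 < Rmin del n0) by (apply Rmin_glb_lt; [apply cond_pos | exact Hn0]).
  apply (sech_hat_not_locally_zero n0 (Rmin del n0) Hm).
  intros y Hy. pose proof (Rmin_l del n0). pose proof (Rmin_r del n0).
  assert (Hy0 : 0 < y) by (apply Rabs_def2 in Hy; lra).
  assert (HyN : Rabs (N y - Gam) < eps).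
  { apply Hdel. change (Rabs (y - n0) < del). lra. }
  assert (Hz : mel_amp c (L, N y) = 0).
  { apply He. split; simpl.
    - apply ball_center.
    - exact HyN. }
  unfold mel_amp in Hz. rewrite (Hnu y Hy0) in Hz. simpl fst in Hz; simpl snd in Hz.
  apply Rmult_integral in Hz as [Hz|Hz]; [exfalso|exact Hz].
  apply Rmult_integral in Hz as [Hz|Hz]; [contradiction|].
  assert (0 < L ^ 5 * (12 * L ^ 2 + 3 / 2 * N y ^ 2)); [|lra].
  apply Rmult_lt_0_compat; [now apply pow_lt | nra].
Qed.

Lemma mel_amp_homogeneous c L Gam :
  0 < L -> 5 * Gam ^ 2 < 3 * L ^ 2 ->
  mel_amp c (2 * L, 2 * Gam) = 2 ^ 7 * mel_amp c (L, Gam).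
Proof.
  intros HL H. unfold mel_amp, sep_nu; simpl fst; simpl snd.
  assert (Hs : 0 < sqrt (6 * L ^ 2 - 10 * Gam ^ 2)) by (apply sqrt_lt_R0; lra).
  replace (sqrt (6 * (2 * L) ^ 2 - 10 * (2 * Gam) ^ 2)) with (2 * sqrt (6 * L ^ 2 - 10 * Gam ^ 2)).
  - replace (2 * Gam * / (2 * sqrt (6 * L ^ 2 - 10 * Gam ^ 2))) with
      (Gam * / sqrt (6 * L ^ 2 - 10 * Gam ^ 2)) by (field; lra). ring.
  - rewrite <- (sqrt_pow2 2) at 1 by lra. rewrite <- sqrt_mult by lra. f_equal. ring.
Qed.

Lemma mult_sin_nondegenerate (F : R -> R) A :
  A <> 0 -> (forall x, F x = A * sin x) -> has_nondegenerate_critical_points F.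
Proof.
  intros HA HF.
  assert (Hd : forall x, is_derive F x (A * cos x)).
  { intros x. apply (is_derive_ext (fun x => A * sin x)); [intros; symmetry; apply HF|].
    auto_derive; [exact I | ring]. }
  assert (HD : forall x, Derive F x = A * cos x) by (intros; apply is_derive_unique, Hd).
  split.
  - exists (PI / 2). unfold critical_point. replace 0 with (A * cos (PI / 2)); [apply Hd|].
    rewrite cos_PI2; ring.
  - intros x Hx. apply is_derive_unique in Hx. rewrite HD in Hx.
    exists (- A * sin x). split.
    + apply (is_derive_ext (fun x => A * cos x)); [intros; symmetry; apply HD|].
      auto_derive; [exact I | ring].
    + apply Rmult_integral in Hx as [Hx|Hx]; [contradiction|].
      intros Hz. apply Rmult_integral in Hz as [Hz|Hz]; [lra|].
      pose proof (sin2_cos2 x) as H1. unfold Rsqr in H1. rewrite Hz, Hx in H1. lra.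
Qed.

Theorem proposition4p1 (a2 e2 mu1 M1 : R)
  (ha2 : 0 < a2) (he2 : 0 < e2 < 1) (hmu1 : 0 < mu1) (hM1 : 0 < M1) :
  (forall L1 Gam gam0 : R, dom_O (L1, Gam) ->
     (exists! h : motion, is_separatrix L1 Gam gam0 h) /\
     is_RInt_gen
       (H2_along a2 e2 mu1 M1 L1 Gam (separatrix L1 Gam gam0))
       (Rbar_locally m_infty) (Rbar_locally p_infty)
       (melnikov a2 e2 mu1 M1 L1 Gam gam0)) /\
  exists Lplus : R * R -> C,
    Canalytic_on dom_O Lplus /\
    ~ (exists c : C, forall p, dom_O p -> Lplus p = c) /\
    (forall L1 Gam gam0 : R, dom_O (L1, Gam) ->
       RtoC (melnikov a2 e2 mu1 M1 L1 Gam gam0) =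
       Cplus (Cmult (Lplus (L1, Gam)) (cis gam0))
             (Cmult (Cconj (Lplus (L1, Gam))) (cis (- gam0)))) /\
    exists Z : R * R -> Prop,
      analytic_subset dom_O Z /\ empty_interior Z /\
      forall L1 Gam : R, dom_O (L1, Gam) -> ~ Z (L1, Gam) ->
        Lplus (L1, Gam) <> RtoC 0 /\
        has_nondegenerate_critical_points
          (melnikov a2 e2 mu1 M1 L1 Gam).
Proof.
  set (c := mel_const a2 e2 mu1 M1).
  assert (Hc : c <> 0) by now apply mel_const_neq_0.
  assert (HI : forall L1 Gam gam0, dom_O (L1, Gam) ->
    is_RInt_gen (H2_along a2 e2 mu1 M1 L1 Gam (separatrix L1 Gam gam0))
      (Rbar_locally m_infty) (Rbar_locally p_infty) (mel_amp c (L1, Gam) * sin gam0)).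
  { intros L1 Gam gam0 Hp. apply dom_O_bounds in Hp as [HL [HG H]].
    now apply is_RInt_gen_melnikov. }
  assert (Hmel : forall L1 Gam gam0, dom_O (L1, Gam) ->
    melnikov a2 e2 mu1 M1 L1 Gam gam0 = mel_amp c (L1, Gam) * sin gam0).
  { intros L1 Gam gam0 Hp. apply is_RInt_gen_unique, HI, Hp. }
  split.
  { intros L1 Gam gam0 Hp. split.
    - apply dom_O_bounds in Hp as [HL [HG H]].
      exists (sep_motion L1 Gam gam0). split; [now apply sep_is_separatrix|].
      intros h Hh. symmetry. now apply separatrix_unique.
    - rewrite Hmel by exact Hp. now apply HI. }
  (* From A sin x = - (i A / 2) exp (i x) + (i A / 2) exp (- i x) with A real. *)
  exists (fun p => (0, - (1 / 2) * mel_amp c p)).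
  split; [|split; [|split]].
  - split; intros p Hp; apply hanalytic_analytic_at.
    + apply (hanalytic_const 0).
    + apply (hanalytic_mult (fun _ => - (1 / 2)) (mel_amp c)); [apply hanalytic_const|].
      now apply mel_amp_hanalytic.
  - intros [z Hz].
    (* The domain is invariant under doubling, which multiplies the amplitude by 2^7: a constant
       amplitude would have to be zero, against [mel_amp_zero_interior]. *)
    assert (Hzero : forall p, dom_O p -> mel_amp c p = 0).
    { intros [L Gam] Hp. assert (Hp2 : dom_O (2 * L, 2 * Gam)).
      { apply dom_O_bounds in Hp. apply dom_O_bounds. repeat split; lra. }
      assert (E1 := Hz _ Hp). assert (E2 := Hz _ Hp2). rewrite <- E2 in E1.
      apply (f_equal snd) in E1. simpl snd in E1.
      apply dom_O_bounds in Hp as [HL [HG H]].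
      rewrite mel_amp_homogeneous in E1 by assumption. lra. }
    assert (Hp0 : dom_O (2, 1)) by (apply dom_O_bounds; lra).
    apply (mel_amp_zero_interior c (2, 1) Hc Hp0).
    apply (filter_imp dom_O); [exact Hzero | apply dom_O_open, Hp0].
  - intros L1 Gam gam0 Hp. rewrite Hmel by exact Hp.
    unfold RtoC, Cplus, Cmult, Cconj, cis; simpl. rewrite cos_neg, sin_neg.
    f_equal; field.
  - exists (fun p => dom_O p /\ mel_amp c p = 0). split; [|split].
    + split; [intros p Hp; apply Hp|]. intros p Hp.
      exists dom_O, 1%nat, (fun _ => mel_amp c).
      split; [exact dom_O_open|]. split; [exact Hp|]. split; [auto|]. split.
      * intros j _ q Hq. now apply hanalytic_analytic_at, mel_amp_hanalytic.
      * intros q Hq. split.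
        -- intros [_ Hz] j _. exact Hz.
        -- intros Hz. split; [exact Hq | apply (Hz O); lia].
    + intros p Hl. apply (mel_amp_zero_interior c p Hc).
      * apply (locally_singleton _ _ Hl).
      * eapply filter_imp; [|exact Hl]. intros q Hq; apply Hq.
    + intros L1 Gam Hp HZ.
      assert (Hamp : mel_amp c (L1, Gam) <> 0) by (intros Hz; apply HZ; split; assumption).
      split.
      * intros Hz. apply (f_equal snd) in Hz. simpl snd in Hz. apply Hamp. lra.
      * apply mult_sin_nondegenerate with (mel_amp c (L1, Gam)); [exact Hamp|].
        intros x. now apply Hmel.
Qed.
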